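(* If $G$ is a maximal outerplanar graph of order $n\ge 3$, then \[\bar{\kappa}_{\max}(G)\le \frac{3}{2}+\frac{n-5}{n(n-1)}.\]
   Context: Graphs are finite and simple. A graph is outerplanar if it has a plane drawing with all vertices on the outer face; it is maximal outerplanar if it is outerplanar and adding any edge destroys this. An orientation of $G$ is obtained by directing each edge. For a digraph $D$ and distinct vertices $u,v$, $\kappa_D(u,v)$ is the maximum number of internally disjoint directed $u$--$v$ paths; for $D$ of order $n$, $\bar{\kappa}(D)=\frac{1}{n(n-1)}\sum_{(u,v)}\kappa_D(u,v)$ over ordered pairs of distinct vertices; $\bar{\kappa}_{\max}(G)$ is the maximum of $\bar{\kappa}(D)$ over all orientations $D$ of $G$. *)

(* Defs.v *)
From HB Require Import structures.
From mathcomp Require Import all_boot all_order all_algebra.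
From mathcomp Require Import all_classical all_reals all_analysis.

Set Implicit Arguments.
Unset Strict Implicit.
Unset Printing Implicit Defensive.

Import Order.TTheory GRing.Theory Num.Theory.
Import numFieldNormedType.Exports.

Local Open Scope classical_set_scope.
Local Open Scope ring_scope.

(* A finite simple graph is a symmetric irreflexive relation e : rel V on
   V : finType; its edges are the finite sets [set u; v]%SET with e u v. *)

Definition is_arc (R : realType) (a b : R * R) (A : set (R * R)) : Prop :=
  exists f : R -> R * R,
    [/\ {within `[0, 1], continuous f},
        {in `[0, 1] &, injective f},
        f 0 = a, f 1 = b & A = f @` `[0, 1]].

Record plane_drawing (R : realType) (V : finType) (e : rel V) := PlaneDrawing {
  dpoint : V -> R * R;
  (* only the values on the edges of e are meaningful *)
  darc : {set V} -> set (R * R);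
  dpoint_inj : injective dpoint;
  darc_is_arc : forall u v, e u v ->
    is_arc (dpoint u) (dpoint v) (darc [set u; v]%SET);
  darc_vertex : forall u v w, e u v ->
    darc [set u; v]%SET (dpoint w) -> w \in [set u; v]%SET;
  darc_disjoint : forall u v x y, e u v -> e x y ->
    [set u; v]%SET != [set x; y]%SET ->
    darc [set u; v]%SET `&` darc [set x; y]%SET `<=` range dpoint
}.

Definition dsupport (R : realType) (V : finType) (e : rel V)
    (D : plane_drawing R e) : set (R * R) :=
  range (dpoint D) `|`
  [set z | exists u v, e u v /\ darc D [set u; v]%SET z].

Definition is_face (R : realType) (V : finType) (e : rel V)
    (D : plane_drawing R e) (F : set (R * R)) : Prop :=
  exists2 z, (~` dsupport D) z & F = connected_component (~` dsupport D) z.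

(* The support is compact, so exactly one face is unbounded. *)
Definition is_outer_face (R : realType) (V : finType) (e : rel V)
    (D : plane_drawing R e) (F : set (R * R)) : Prop :=
  is_face D F /\ ~ bounded_set F.

(* Faces are open, so a vertex lies on a face when it is in its closure. *)
Definition outerplanar (R : realType) (V : finType) (e : rel V) : Prop :=
  exists (D : plane_drawing R e) (F : set (R * R)),
    is_outer_face D F /\ forall v, closure F (dpoint D v).

Definition add_edge (V : finType) (e : rel V) (a b : V) : rel V :=
  fun x y => e x y || ([set x; y]%SET == [set a; b]%SET).

Definition maximal_outerplanar (R : realType) (V : finType) (e : rel V) : Prop :=
  outerplanar R e /\
  forall a b, a != b -> ~~ e a b -> ~ outerplanar R (add_edge e a b).

(* A digraph on V is its set of arcs (u, v), directed from u to v. *)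
Definition is_orientation (V : finType) (e : rel V) (D : {set V * V}) : bool :=
  [forall u, forall v,
     if e u v then ((u, v) \in D) (+) ((v, u) \in D) else (u, v) \notin D].

(* The path is u :: p. *)
Definition is_dipath (V : finType) (D : {set V * V}) (u v : V) (p : seq V) : bool :=
  [&& path (fun x y => (x, y) \in D) u p, last u p == v & uniq (u :: p)].

Definition internal (V : finType) (u : V) (p : seq V) : seq V :=
  behead (belast u p).

(* A duplicate-free u :: p has at most #|V| vertices, so the tails p range over
   the finite type {bseq #|V| of V} of sequences of length at most #|V|. *)
Definition disjoint_dipaths (V : finType) (D : {set V * V}) (u v : V)
    (P : {set {bseq #|V| of V}}) : bool :=
  [forall p in P, is_dipath D u v p] &&
  [forall p in P, forall q in P,
     (p != q) ==> [disjoint internal u p & internal u q]].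

Definition kappa (V : finType) (D : {set V * V}) (u v : V) : nat :=
  \max_(P : {set {bseq #|V| of V}} | disjoint_dipaths D u v P) #|P|.

Definition kappa_bar (R : realType) (V : finType) (D : {set V * V}) : R :=
  (#|V|%:R * (#|V|%:R - 1))^-1 *
  \sum_(uv : V * V | uv.1 != uv.2) (kappa D uv.1 uv.2)%:R.

(* Averages are nonnegative and orientations exist, so the default value 0
   does not change the maximum. *)
Definition kappa_bar_max (R : realType) (V : finType) (e : rel V) : R :=
  \big[Order.max/0]_(D : {set V * V} | is_orientation e D) kappa_bar R D.

(* Main.v *)
(* Sample the arcs of the drawing and count, in quarter turns, how the direction from
   a point to the arcs rotates. A point of the unbounded face sees no winding, hence
   neither does any vertex: for every vertex a the directions to the other vertices b
   lift to integers g a b compatible with the rotation along all edges avoiding a.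
   Since opposite directions differ by two quarter turns, g a b - g b a = 4 k a b + 2,
   and as vertex-disjoint edges ab and xy do not meet, k a x - k b x = k a y - k b y.
   By parity, such a k excludes the subdivisions of K4 and K_{2,3}, so there is a
   vertex of degree at most 2, and inductively the vertices can be ordered so that no
   two edges cross.

   Let A be the set of the a vertices of degree at most 2. A pair meeting A satisfies
   kappa(u,v) + kappa(v,u) <= 2. Put u first in the cyclic order. Two disjoint paths
   between u and v cannot both leave v on the same side, so kappa(u,v) + kappa(v,u) can
   exceed 3 only if v has both an in- and an out-neighbour on one side of it, on both
   sides if u and v are not adjacent. Under such a pair of neighbours hides a vertex
   of A, and the next vertex of A on that side determines v; so the total excess over
   3 of the pairs at u is at most 2a. Summing up, twice the sum of kappa is at most
   3n(n-1) - a(a-1), and a >= 2. *)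
Require Import Defs.
From mathcomp Require Import all_boot all_order all_algebra.
From mathcomp Require Import zify.

Set Implicit Arguments.
Unset Strict Implicit.
Unset Printing Implicit Defensive.

Import Order.TTheory GRing.Theory Num.Theory.

(** * Certificates and noncrossing orders *)

(* The model case is [k a b = 0] if [a] precedes [b] and [-1] otherwise, in an order
   of the vertices without crossing edges. *)
Definition edge_certificate (V : finType) (e : rel V) (k : V -> V -> int) : Prop :=
  (forall a b, a != b -> k a b + k b a + 1 = 0)%R /\
  (forall a b x y, e a b -> e x y -> [&& a != x, a != y, b != x & b != y] ->
     k a x - k b x = k a y - k b y)%R.

Local Open Scope ring_scope.

(** In the sum of the last three equations the two sides differ by an odd number: [ac + ca],
    [bc + cb] and [ab - ba] are odd, and the other terms are even or cancel. *)
Lemma K4_parity (ab ac ad bc bd cd ba ca da cb db dc : int) :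
  ab + ba + 1 = 0 -> ac + ca + 1 = 0 -> ad + da + 1 = 0 ->
  bc + cb + 1 = 0 -> bd + db + 1 = 0 -> cd + dc + 1 = 0 ->
  ac - bc = ad - bd -> bd - cd = ba - ca -> ab - cb = ad - cd -> False.
Proof. lia. Qed.

(** Eliminating [xy - y1], [xy - y2] and [xy - y3] and adding the three resulting equations gives
    [w12 - w21 + (w23 - w32) + (w31 - w13) = 0], a sum of three odd numbers. *)
Lemma K23_parity (x1 x2 x3 xy y1 y2 y3 w12 w13 w21 w23 w31 w32 : int) :
 w12 + w21 + 1 = 0 -> w13 + w31 + 1 = 0 -> w23 + w32 + 1 = 0 ->
 x2 - w12 = xy - y1 -> x3 - w13 = xy - y1 -> x1 - w21 = xy - y2 ->
 x3 - w23 = xy - y2 -> x1 - w31 = xy - y3 -> x2 - w32 = xy - y3 -> False.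
Proof. lia. Qed.

Local Close Scope ring_scope.

Section CertificateMinors.
Variables (V : finType) (e : rel V) (k : V -> V -> int).
Hypotheses (e_sym : symmetric e) (ek : edge_certificate e k).
Local Open Scope ring_scope.

Definition erestr (A : pred V) : rel V := [rel a b | [&& e a b, A a & A b]].

Lemma erestr_sym A : connect_sym (erestr A).
Proof. by apply: sym_connect_sym => a b; rewrite /erestr /= e_sym [A a && _]andbC. Qed.

Lemma erestr1 (A : pred V) a b : e a b -> A a -> A b -> connect (erestr A) a b.
Proof. by move=> eab Aa Ab; apply: connect1; rewrite /erestr /= eab Aa. Qed.

(** The edge identity telescopes along a walk in [A] and along a walk in [B], so connections inside
    disjoint sets can stand for disjoint edges. *)
Lemma certificate_connect (A B : pred V) a a' b b' : (forall v, A v -> ~~ B v) ->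
  connect (erestr A) a a' -> connect (erestr B) b b' ->
  k a b - k a' b = k a b' - k a' b'.
Proof.
move=> AB /connectP[s sA ->]; elim: s a sA => [|a1 s IH] a /=; first by rewrite !subrr.
case/andP=> /and3P[ea Aa Aa1] sA /[dup] cB /(IH _ sA) {}IH.
suff E: k a b - k a1 b = k a b' - k a1 b'.
  by rewrite -(subrK (k a1 b) (k a b)) E -addrA IH addrA subrK.
case/connectP: cB => t tB ->; elim: t b tB {IH} => [|b1 t IHt] b //=.
case/andP=> /and3P[eb Bb Bb1] /IHt {}IHt.
have := ek.2 _ _ _ _ ea eb; suff -> : [&& a != b, a != b1, a1 != b & a1 != b1].
  by move=> /(_ isT) ->.
have ne u v : A u -> B v -> u != v.
  by move=> Au; apply: contraTneq => <-; exact: AB.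
by rewrite !ne.
Qed.

(** The parity equations pair opposite edges, so only the connections for opposite edges have to be
    disjoint. *)
Lemma certificate_no_K4 (a b c d : V) (AB CD BC DA AC BD : pred V) :
  uniq [:: a; b; c; d] ->
  (forall v, AB v -> ~~ CD v) -> (forall v, BC v -> ~~ DA v) ->
  (forall v, AC v -> ~~ BD v) ->
  connect (erestr AB) a b -> connect (erestr CD) c d ->
  connect (erestr BC) b c -> connect (erestr DA) d a ->
  connect (erestr AC) a c -> connect (erestr BD) b d -> False.
Proof.
move=> abcd D1 D2 D3 ab cd bc da ac bd.
move: abcd; rewrite /= !inE !negb_or => /and4P[/and3P[nab nac nad] /andP[nbc nbd] ncd _].
have [H _] := ek; exact: (K4_parity (H _ _ nab) (H _ _ nac) (H _ _ nad) (H _ _ nbc)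
  (H _ _ nbd) (H _ _ ncd) (certificate_connect D1 ab cd)
  (certificate_connect D2 bc da) (certificate_connect D3 ac bd)).
Qed.

(** Each equation pairs the edge from [x] to one of the [w]s with a connection from another one to
    [y]; hence the three connections may meet each other. *)
Lemma certificate_no_K23 (x y w1 w2 w3 : V) (B1 B2 B3 : pred V) :
  uniq [:: w1; w2; w3; y] -> e x w1 -> e x w2 -> e x w3 ->
  [/\ ~~ B1 x, ~~ B1 w2 & ~~ B1 w3] -> [/\ ~~ B2 x, ~~ B2 w1 & ~~ B2 w3] ->
  [/\ ~~ B3 x, ~~ B3 w1 & ~~ B3 w2] ->
  connect (erestr B1) w1 y -> connect (erestr B2) w2 y ->
  connect (erestr B3) w3 y -> False.
Proof.
move=> uw ew1 ew2 ew3 [B1x B12 B13] [B2x B21 B23] [B3x B31 B32] c1 c2 c3.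
have sq w w' (B : pred V) : e x w -> ~~ B x -> ~~ B w -> connect (erestr B) w' y ->
    k x w' - k w w' = k x y - k w y.
  move=> ew Bx Bw; apply: (@certificate_connect (pred2 x w)).
    by move=> v /= /orP[] /eqP ->.
  by apply: erestr1; rewrite //= eqxx ?orbT.
move: uw; rewrite /= !inE !negb_or => /and4P[/and3P[n12 n13 n1y] /andP[n23 n2y] n3y _].
have [H _] := ek; exact: (K23_parity (H _ _ n12) (H _ _ n13) (H _ _ n23)
  (sq w1 w2 _ ew1 B2x B21 c2) (sq w1 w3 _ ew1 B3x B31 c3) (sq w2 w1 _ ew2 B1x B12 c1)
  (sq w2 w3 _ ew2 B3x B32 c3) (sq w3 w1 _ ew3 B1x B13 c1) (sq w3 w2 _ ew3 B2x B23 c2)).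
Qed.

Lemma path_erestr x s v w : path e x s -> v \in x :: s -> w \in x :: s ->
  connect (erestr [in x :: s]) v w.
Proof.
move=> xs.
have xs' : path (erestr [in x :: s]) x s.
  apply: (@sub_in_path _ [in x :: s] e) xs => [a b Aa Ab eab|].
    by apply/and3P.
  by apply/allP.
move=> /(path_connect xs') xv /(path_connect xs') xw.
by apply: connect_trans xw; rewrite erestr_sym.
Qed.

Lemma erestr_sub (A B : pred V) a b : (forall v, A v -> B v) ->
  connect (erestr A) a b -> connect (erestr B) a b.
Proof.
move=> AB; apply: connect_sub => u v /= /and3P[uv Au Av].
by apply: erestr1; rewrite ?AB.
Qed.
End CertificateMinors.

(** * A vertex of degree at most 2 *)

Section DegreeTwo.
Variables (V : finType) (e : rel V) (k : V -> V -> int).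
Hypotheses (e_sym : symmetric e) (ek : edge_certificate e k).

(* In a longest path starting at [x], all neighbours of [x] lie on the path. If
   [c] is a neighbour of [x] that is neither the first nor the last of these, then
   reversing the part before [c] gives a longest path whose initial vertex [b] sees
   nothing beyond [c], since otherwise there would be a [K4]. *)
Lemma certificate_degree_le2 (S : {set V}) x0 : irreflexive e -> x0 \in S ->
  (forall x y, x \in S -> e x y -> y \in S) ->
  exists2 w, w \in S & #|[set y | e w y]| <= 2.
Proof.
move=> e_irr x0S eS; apply/exists_inP; apply: contraT => /exists_inPn deg; exfalso.
pose P n := [exists x in S, exists t : n.-tuple V, path e x t && uniq (x :: t)].
have PP x t : x \in S -> path e x t -> uniq (x :: t) -> P (size t).
  move=> xS xt ut; apply/exists_inP; exists x => //; apply/existsP; exists (in_tuple t).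
  by rewrite xt.
have [||L PL maxL] := @ex_maxnP P #|V|; first by exists 0; apply: (PP x0 [::]).
  move=> n /exists_inP[x _ /existsP[t /andP[_ ut]]].
  by rewrite -(size_tuple t) ltnW // -[_.+1]/(size (x :: t)) -(card_uniqP ut) max_card.
have pathS x t : x \in S -> path e x t -> {subset t <= S}.
  elim: t x => // z t IHt x xS /= /andP[/(eS _ _ xS) zS zt] v.
  by rewrite inE => /orP[/eqP->//|]; exact: IHt zt v.
have nbr x t y : x \in S -> path e x t -> uniq (x :: t) -> size t = L -> e x y ->
    y \in x :: t.
  move=> xS xt ut tL exy; apply/negPn/negP => yxt.
  have yp : path e y (x :: t) by rewrite /= e_sym exy.
  have yu : uniq (y :: x :: t) by rewrite cons_uniq yxt.
  by have := maxL _ (PP _ _ (eS _ _ xS exy) yp yu); rewrite /= tL ltnn.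
have [x xS /existsP[t /andP[xt ut]]] := exists_inP PL.
(* Induction on a bound [m] for the position of the farthest neighbour of the initial vertex: each
   reversal lowers this bound. *)
suff H m : forall x t, x \in S -> path e x t -> uniq (x :: t) -> size t = L ->
    ~ (forall y, e x y -> index y (x :: t) <= m).
  apply: (H (size (x :: t)) x t xS xt ut); first by rewrite size_tuple.
  by move=> y _; exact: index_size.
elim: m {x t xS xt ut} => [|m IH] x t xS xt ut tL reach;
  (have /card_gt0P[y0] : 0 < #|[set y | e x y]|
     by have := deg x xS; rewrite -ltnNge; apply: leq_ltn_trans);
  rewrite inE => xy0.
  have := reach _ xy0; rewrite leqn0 /=; case: (x =P y0) => // xy.
  by rewrite xy e_irr in xy0.
have [y exy ymax] := @arg_maxnP _ y0 (e x) (fun y => index y (x :: t)) xy0.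
have /card_gt0P[c] : 0 < #|[set y | e x y] :\ y :\ nth x (x :: t) 1|.
  have := deg x xS; rewrite -ltnNge (cardsD1 y) (cardsD1 (nth x (x :: t) 1)).
  by case: (_ \in _); case: (_ \in _); case: #|_|.
rewrite !inE => /and3P[c1 cy exc].
have cs := nbr x t c xS xt ut tL exc; have ys := nbr x t y xS xt ut tL exy.
have cx : c != x by apply: contraTneq exc => ->; rewrite e_irr.
have ct : c \in t by move: cs; rewrite inE (negPf cx).
have icy : index c (x :: t) < index y (x :: t).
  rewrite ltn_neqAle [_ <= _]ymax // andbT; apply: contraNneq cy => E.
  by rewrite -(nth_index x cs) E nth_index.
have ym := reach y exy.
have ic1 : 1 < index c (x :: t).
  move: (nth_index x cs) c1; case: (index c _) => [/= E|[|//]]; first by rewrite E eqxx in cx.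
  by move=> ->; rewrite eqxx.
case/splitPr: ct xt ut tL ys icy ym ic1 {reach c1 ymax cs} => t1 t2.
case/lastP: t1 => [|t1 b]; first by rewrite /= eq_sym (negPf cx) eqxx.
rewrite cat_path last_rcons => /andP[xt1 bct2] ut tL ys icy ym ic1.
have [ebc ct2] : e b c /\ path e c t2 by apply/andP.
pose t' := rcons (rev t1) x ++ c :: t2.
have t'E : b :: t' = rev (x :: rcons t1 b) ++ c :: t2.
  by rewrite rev_cons rev_rcons.
have pt' : perm_eq (b :: t') (x :: rcons t1 b ++ c :: t2).
  by rewrite t'E -cat_cons perm_cat2r perm_rev.
have ut' : uniq (b :: t') by rewrite (perm_uniq pt').
have st' : size t' = L by have := perm_size pt'; rewrite /= tL => -[].
have bt' : path e b t'.
  rewrite cat_path last_rcons /= exc ct2 !andbT.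
  have := rev_path e x (rcons t1 b).
  rewrite last_rcons belast_rcons rev_cons => ->.
  by rewrite (eq_path (e' := e)) // => u v; rewrite e_sym.
have ic : index c (x :: rcons t1 b ++ c :: t2) = (size t1).+2.
  rewrite -cat_cons index_cat index_head addn0 /= size_rcons ifN //.
  by move: ut; rewrite -cat_cons cat_uniq => /and3P[_ /hasPn/(_ c (mem_head _ _))].
have yt2 : y \in t2.
  move: ys icy; rewrite ic -cat_cons mem_cat index_cat [y \in c :: _]inE.
  case: ifP => [yx _|_ /= /orP[/eqP->|//]].
    by move: yx; rewrite -index_mem /= size_rcons => /ltn_trans H /H; rewrite ltnn.
  by rewrite eqxx addn0 size_rcons ltnn.
have bS : b \in S by apply: (pathS x _ xS xt1); rewrite mem_rcons mem_head.
apply: (IH b t' bS bt' ut' st') => v ebv.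
have := nbr b t' v bS bt' ut' st' ebv.
rewrite t'E mem_cat index_cat; case: ifP => [vt1 _|_ /=].
  move: vt1; rewrite -index_mem size_rev /= size_rcons ltnS => /leq_trans; apply.
  by rewrite -ltnS -ic; exact: leq_trans (ltnW icy) ym.
rewrite inE eq_sym; case: eqP => [_ _|_ /= vt2].
  rewrite size_rev /= size_rcons addn0 -ltnS -ic.
  exact: leq_trans icy ym.
exfalso; move: ut; rewrite -cat_cons cat_uniq => /and3P[ut1 /hasPn dis ut2].
have xb : x != b.
  by apply: contraTneq ut1 => ->; rewrite /= mem_rcons mem_head.
have xt2 z : z \in c :: t2 -> z != x.
  by move=> /dis; apply: contraNneq => ->; rewrite mem_head.
have bt2 z : z \in c :: t2 -> z != b.
  by move=> /dis; apply: contraNneq => ->; rewrite inE mem_rcons mem_head orbT.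
have ct2' z : z \in t2 -> z != c.
  by move=> zt2; apply: contraTneq ut2 => <-; rewrite /= zt2.
have inc z : z \in t2 -> z \in c :: t2 by rewrite inE orbC => ->.
(* Opposite connections: the path from [x] to [b] and the one from [c] to [y]; the edges [bc] and
   [yx]; the edge [xc] and the connection from [b] through its neighbour [v] to [y] inside [t2]. *)
apply: (@certificate_no_K4 V e k ek x b c y [in x :: rcons t1 b] [in c :: t2]
  (pred2 b c) (pred2 y x) (pred2 x c) [in b :: t2]).
- rewrite /= !inE !negb_or xb (eq_sym x c) (eq_sym x y) (eq_sym b c) (eq_sym b y).
  by rewrite (eq_sym c y) !xt2 ?bt2 ?ct2' ?mem_head ?inc.
- by move=> z /= zt1; apply/negP => /dis; rewrite zt1.
- move=> z /= /orP[] /eqP ->; rewrite negb_or (eq_sym _ x) ?(eq_sym b) ?(eq_sym c).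
    by rewrite xb bt2 // inc.
  by rewrite ct2' // eq_sym xt2 ?mem_head.
- move=> z /= /orP[] /eqP ->; rewrite inE negb_or.
    by rewrite xb; apply/negP => /inc/xt2; rewrite eqxx.
  by rewrite bt2 ?mem_head //; apply/negP => /ct2'; rewrite eqxx.
- by apply: path_erestr; rewrite ?mem_head // inE mem_rcons mem_head orbT.
- by apply: path_erestr => //; rewrite ?mem_head ?inc.
- by apply: erestr1; rewrite //= eqxx ?orbT.
- by apply: erestr1; rewrite //= ?eqxx ?orbT // e_sym.
- by apply: erestr1; rewrite //= eqxx ?orbT.
apply: (@connect_trans _ _ v).
  by apply: erestr1; rewrite //= inE ?eqxx ?vt2 ?orbT.
apply: (@erestr_sub _ _ [in t2]); first by move=> z /=; rewrite inE orbC => ->.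
by case: (t2) ct2 vt2 yt2 => // z t3 /= /andP[_ zt3]; exact: path_erestr.
Qed.
End DegreeTwo.

(** * Noncrossing orders *)

Section Noncrossing.
Variables (V : finType) (e : rel V).
Hypothesis e_sym : symmetric e.
Implicit Type pos : V -> nat.

Definition noncrossing pos : Prop := forall a b c d,
  pos a < pos b -> pos b < pos c -> pos c < pos d -> e a c -> ~~ e b d.

Lemma noncrossing_enclosed pos a b c d : noncrossing pos ->
  pos a < pos b -> pos b < pos c -> e a c -> e b d -> pos a <= pos d <= pos c.
Proof.
move=> nc ab bc eac ebd; apply/andP; split; rewrite leqNgt; apply/negP => d_out.
  by have := nc d a b c d_out ab bc; rewrite e_sym ebd eac => /(_ isT).
by have := nc a b c d ab bc d_out eac; rewrite ebd.
Qed.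

(** Being noncrossing depends only on the cyclic order, up to reversal. [rotate] and [mirror] put
    [u] first in the two directions, so that an argument for one side covers both. *)
Definition rotate (u : V) pos (v : V) : nat :=
  if pos v < pos u then pos v + (\max_w pos w).+1 else pos v.

Definition reflect_pos pos (v : V) : nat := \max_w pos w - pos v.

Definition mirror (u : V) pos : V -> nat := rotate u (reflect_pos pos).

Lemma le_max_pos pos v : pos v <= \max_w pos w.
Proof. exact: leq_bigmax. Qed.

Lemma rotate_min u pos v : rotate u pos u <= rotate u pos v.
Proof.
rewrite /rotate ltnn; case: ltnP => // _.
by apply: leq_trans (le_max_pos pos u) _; rewrite addnS ltnW // ltnS leq_addl.
Qed.

Lemma rotate_inj u pos (S : {set V}) :
  {in S &, injective pos} -> {in S &, injective (rotate u pos)}.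
Proof.
move=> pos_inj v w vS wS; rewrite /rotate.
have := le_max_pos pos v; have := le_max_pos pos w.
by case: ifP => _; case: ifP => _ Hw Hv E; apply: pos_inj => //; lia.
Qed.

Lemma rotate_noncrossing u pos : noncrossing pos -> noncrossing (rotate u pos).
Proof.
move=> nc a b c d; rewrite /rotate.
move: (le_max_pos pos a) (le_max_pos pos b) (le_max_pos pos c) (le_max_pos pos d).
move=> Ma Mb Mc Md ab bc cd eac; apply/negP => ebd.
have nd p q r s : e p r -> e q s -> pos p < pos q < pos r -> pos r < pos s -> False.
  by move=> epr eqs /andP[pq qr] rs; have := nc p q r s pq qr rs epr; rewrite eqs.
have [eca edb] : e c a /\ e d b by rewrite !(e_sym _ a) !(e_sym _ b).
have := nd a b c d eac ebd; have := nd b c d a ebd eca.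
have := nd c d a b eca edb; have := nd d a b c edb eac; clear nd nc eac ebd eca edb.
move: ab bc cd; move: (\max_w _) Ma Mb Mc Md => M; case: (ltnP (pos a)); case: (ltnP (pos b));
  case: (ltnP (pos c)); case: (ltnP (pos d)); lia.
Qed.

Lemma reflect_noncrossing pos : noncrossing pos -> noncrossing (reflect_pos pos).
Proof.
move=> nc a b c d ab bc cd eac; rewrite e_sym; apply/negP => edb.
rewrite /reflect_pos in ab bc cd.
have [dc cb ba] : [/\ pos d < pos c, pos c < pos b & pos b < pos a] by split; lia.
by have := nc d c b a dc cb ba edb; rewrite e_sym eac.
Qed.

Lemma mirror_noncrossing u pos : noncrossing pos -> noncrossing (mirror u pos).
Proof. by move=> nc; apply: rotate_noncrossing; exact: reflect_noncrossing. Qed.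

Lemma mirror_inj u pos (S : {set V}) :
  {in S &, injective pos} -> {in S &, injective (mirror u pos)}.
Proof.
move=> pos_inj; apply: rotate_inj => v w vS wS E; apply: pos_inj => //.
by move: E (le_max_pos pos v) (le_max_pos pos w); rewrite /reflect_pos; lia.
Qed.

Lemma rotate_injective u pos : injective pos -> injective (rotate u pos).
Proof.
move=> pos_inj; have inj : {in [set: V] &, injective (rotate u pos)}.
  by apply: rotate_inj => a b _ _; exact: pos_inj.
by move=> a b; apply: inj; rewrite inE.
Qed.

Lemma mirror_injective u pos : injective pos -> injective (mirror u pos).
Proof.
move=> pos_inj; have inj : {in [set: V] &, injective (mirror u pos)}.
  by apply: mirror_inj => a b _ _; exact: pos_inj.
by move=> a b; apply: inj; rewrite inE.
Qed.

Lemma mirror_lt u pos v w : pos u < pos v -> pos u < pos w ->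
  (mirror u pos v < mirror u pos w) = (pos w < pos v).
Proof.
move=> uv uw; rewrite /mirror /rotate /reflect_pos.
move: (le_max_pos pos u) (le_max_pos pos v) (le_max_pos pos w).
by case: ifP; case: ifP; lia.
Qed.

Lemma mirror_min u pos v : mirror u pos u <= mirror u pos v.
Proof. exact: rotate_min. Qed.
End Noncrossing.

Lemma path_jump (V : finType) (r : rel V) (pos : V -> nat) m x s : path r x s ->
  pos x < m -> m < pos (last x s) -> {in x :: s, forall z, pos z != m} ->
  exists a b, [/\ r a b, connect r x b, pos a < m & m < pos b].
Proof.
elim: s x => [|z s IH] x /=; first by move=> _ /ltn_trans H /H; rewrite ltnn.
case/andP=> xz zs xm ml H; have [zm|mz|zm] := ltngtP (pos z) m.
- have [u us|a [b [ab zb am mb]]] := IH z zs zm ml.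
    by apply: H; rewrite inE us orbT.
  by exists a, b; split=> //; apply: connect_trans zb; exact: connect1.
- by exists x, z; split=> //; exact: connect1.
- by have := H z; rewrite !inE eqxx orbT zm eqxx => /(_ isT).
Qed.

(** The gap [g] is the position of the last vertex of the component of [x] among the vertices before
    [y]. An edge over it from the component ends in [y], and if it does not start in [x] then the
    first alternative holds; one from outside would cross an edge of the component. *)
Lemma noncrossing_gap (V : finType) (e : rel V) (S : {set V}) pos x y :
  symmetric e -> (forall a b, e a b -> a \in S) -> {in S &, injective pos} ->
  noncrossing e pos -> (forall v, pos x <= pos v) -> x \in S -> y \in S ->
  pos x < pos y ->
  (exists z, [/\ e x z, pos x < pos z < pos y &
     connect (erestr e [pred v | pos x < pos v <= pos y]) z y]) \/
  (exists2 g, pos x <= g < pos y & forall p q, e p q -> pos p <= g -> g < pos q ->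
     pos q <= pos y -> p = x /\ q = y).
Proof.
move=> e_sym eS pos_inj nc x_min xS yS xy.
set A := [pred v | pos x < pos v <= pos y].
pose r := erestr e [pred v | pos v < pos y].
case: (boolP [exists z, [&& e x z, pos x < pos z < pos y & connect (erestr e A) z y]]).
  by case/existsP=> z /and3P[exz xzy zy]; left; exists z.
move/existsPn=> nobridge; right.
have eS' a b : e a b -> b \in S by rewrite e_sym; exact: eS.
have lt_x v : v \in S -> v != x -> pos x < pos v.
  move=> vS vx; rewrite ltn_neqAle x_min andbT; apply: contraNneq vx => E.
  by apply/eqP; apply: pos_inj.
have C_lt v : connect r x v -> pos v < pos y.
  have cl : closed r [pred v | pos v < pos y].
    by move=> a b /and3P[_ /= ay yb]; rewrite !unfold_in /= ay yb.
  by move=> /(closed_connect cl); rewrite !unfold_in /= xy => <-.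
have C_S v : connect r x v -> v \in S.
  have cl : closed r S.
    by move=> a b /and3P[ab _ _]; rewrite (eS _ _ ab) (eS' _ _ ab).
  by move=> /(closed_connect cl); rewrite xS => <-.
have [v Cv vmax] := @arg_maxnP _ x (connect r x) pos (connect0 r x).
exists (pos v); first by rewrite x_min C_lt.
move=> p q pq pv vq qy.
have [Cp|Cp] := boolP (connect r x p).
  have qyE : q = y.
    apply: pos_inj (eS' _ _ pq) yS _; apply/eqP; rewrite eqn_leq qy leqNgt.
    apply/negP => q_lt; have /vmax : connect r x q.
      by apply: (connect_trans Cp); apply: erestr1; rewrite //= C_lt.
    by move=> /(leq_trans vq); rewrite ltnn.
  split=> //; apply/eqP; apply: contraT => px; exfalso.
  have p_y := C_lt _ Cp.
  case/connectP: Cp => s /shortenP[[|z s'] rs us _ pE]; first by rewrite pE eqxx in px.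
  have [exz zy zs' xs'] : [/\ e x z, pos z < pos y, path r z s' & x \notin z :: s'].
    by case/andP: rs => /and3P[? _ ?] ?; case/andP: us => ?.
  have s'S u : u \in z :: s' -> u \in S.
    move=> us'; apply: C_S; apply: (connect_trans (connect1 _)).
      by apply/and3P; split; [exact: exz | exact: xy | exact: zy].
    exact: (path_connect zs').
  have gt_x u : u \in z :: s' -> pos x < pos u.
    by move=> us'; apply: lt_x (s'S _ us') _; apply: contraNneq xs' => <-.
  have /negP := nobridge z; apply; rewrite exz gt_x ?mem_head // zy /=.
  apply: (@connect_trans _ _ p).
    apply/connectP; exists s' => //; apply: (@sub_in_path _ [in z :: s'] r) zs' => [a b|].
    + move=> /gt_x xa /gt_x xb /and3P[ab /= ay yb].
      by apply/and3P; split=> //=; rewrite ?xa ?xb ltnW.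
    + exact/allP.
  apply: erestr1; first by rewrite -qyE.
  - by rewrite /= lt_x ?(eS _ _ pq) // ltnW.
  - by rewrite /= xy leqnn.
exfalso; have pS := eS _ _ pq.
have px : p != x by apply: contraNneq Cp => ->; exact: connect0.
have p_v : pos p != pos v.
  by apply: contraNneq Cp => /(pos_inj _ _ pS (C_S _ Cv)) ->.
have pv' : pos p < pos v by rewrite ltn_neqAle p_v.
case/connectP: (Cv) => s rs vE.
(* The path from [x] to [v] has an edge [ab] passing over [p]; as [q] lies beyond [v] and hence
   beyond [b], the edges [ab] and [pq] cross. *)
have [||u us|a [b [ab xb ap pb]]] := @path_jump _ r pos (pos p) x s rs.
- exact: lt_x.
- by rewrite -vE.
- have Cu : connect r x u by apply: (path_connect rs).
  by apply: contraNneq Cp => /(pos_inj _ _ (C_S _ Cu) pS) <-.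
have bv : pos b <= pos v := vmax _ xb.
have := nc a p b q ap pb (leq_ltn_trans bv vq); case/and3P: ab => -> _ _ /(_ isT).
by rewrite pq.
Qed.

(** * Inserting a vertex into a noncrossing order *)

Section Insertion.
Variables (V : finType) (e : rel V) (w : V) (pos : V -> nat).
Hypothesis e_sym : symmetric e.

Definition delete_vertex : rel V := [rel a b | [&& e a b, a != w & b != w]].

(** Doubling the positions frees the odd value [g.*2.+1] for [w], just after the vertices at
    positions up to [g]. *)
Definition insert_vertex (g : nat) (v : V) : nat :=
  if v == w then g.*2.+1 else (pos v).*2.

Hypothesis nc : noncrossing delete_vertex pos.

Lemma insert_vertex_inj g (S : {set V}) :
  {in S :\ w &, injective pos} -> {in S &, injective (insert_vertex g)}.
Proof.
move=> pos_inj a b aS bS; rewrite /insert_vertex.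
case: (eqVneq a w) => [->|aw]; case: (eqVneq b w) => [->//|bw] E; try lia.
by apply: pos_inj; rewrite ?inE ?aw ?bw //; lia.
Qed.

(** Directly after its only possible neighbour, [w] has no edge that passes over another position of
    [delete_vertex]. *)
Lemma insert_vertex_noncrossing_pendant x : irreflexive e ->
  (forall z, e w z -> z = x) -> noncrossing e (insert_vertex (pos x)).
Proof.
move=> e_irr ew a b c d ab bc cd eac; apply/negP => ebd.
have ew' z : e z w -> z = x by rewrite e_sym; exact: ew.
have xw : e w x -> x != w by apply: contraTneq => ->; rewrite e_irr.
move: ab bc cd; rewrite /insert_vertex.
case: (eqVneq a w) => [aw|aw].
  rewrite aw in eac; rewrite (ew _ eac) (negPf (xw _)) ?(ew _ eac) -?(ew _ eac) //.
  case: (eqVneq b w) => _; lia.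
case: (eqVneq c w) => [cw|cw].
  rewrite cw in eac; have := ew' _ eac => ax; rewrite ax; case: (eqVneq b w) => _; lia.
case: (eqVneq b w) => [bw|bw].
  rewrite bw in ebd; rewrite -(ew _ ebd); case: (eqVneq d w) => _; lia.
case: (eqVneq d w) => [dw|dw].
  rewrite dw in ebd; rewrite -(ew' _ ebd); lia.
rewrite !ltn_double => ab bc cd.
by have := nc ab bc cd; rewrite /delete_vertex /= eac ebd aw bw cw dw => /(_ isT).
Qed.

(** An edge crossing [xw] or [wy] has an end strictly between [x] and [y]. It cannot run beyond [y],
    and if it passes over the gap it is [xy], which crosses neither. *)
Lemma insert_vertex_noncrossing x y g : x != w -> y != w ->
  (forall z, e w z -> z = x \/ z = y) -> (forall v, pos x <= pos v) ->
  pos x <= g < pos y ->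
  (forall p q, delete_vertex p q -> pos x < pos p < pos y -> pos q <= pos y) ->
  (forall p q, delete_vertex p q -> pos p <= g -> g < pos q -> pos q <= pos y ->
     p = x /\ q = y) ->
  noncrossing e (insert_vertex g).
Proof.
move=> xw yw ew x_min /andP[xg gy] encl gap a b c d ab bc cd eac; apply/negP => ebd.
have ew' z : e z w -> z = x \/ z = y by rewrite e_sym; exact: ew.
have del p q : e p q -> p != w -> q != w -> delete_vertex p q.
  by move=> pq pw qw; rewrite /delete_vertex /= pq pw.
move: ab bc cd; rewrite /insert_vertex.
case: (eqVneq a w) => [aw|aw].
  rewrite aw in eac; case: (eqVneq b w) => [|bw ab]; first lia.
  have [-> | ->] := ew _ eac; rewrite ?(negPf xw) ?(negPf yw); first lia.
  case: (eqVneq d w) => [|dw] bc cd; first lia.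
  have := encl _ _ (del _ _ ebd bw dw); lia.
case: (eqVneq c w) => [cw|cw].
  rewrite cw in eac; case: (eqVneq b w) => [|bw ab bc]; first lia.
  case: (eqVneq d w) => [|dw cd]; first lia.
  have [ax|ay] := ew' _ eac; last by rewrite ay in ab; lia.
  rewrite ax in ab; have := encl _ _ (del _ _ ebd bw dw) => dy.
  have [] : b = x /\ d = y by apply: gap (del _ _ ebd bw dw) _ _ _; lia.
  by move=> bx; rewrite bx in ab; lia.
have dac := del _ _ eac aw cw.
case: (eqVneq b w) => [bw ab|bw].
  rewrite bw in ebd; have [-> | ->] := ew _ ebd; rewrite ?(negPf xw) ?(negPf yw); first lia.
  move=> bc cd; have [] : a = x /\ c = y by apply: gap dac _ _ _; lia.
  by move=> _ cy; rewrite cy in cd; lia.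
case: (eqVneq d w) => [dw|dw].
  rewrite dw in ebd; have [bx|by_] := ew' _ ebd.
    by have := x_min a; rewrite bx; lia.
  by rewrite by_; lia.
rewrite !ltn_double => ab bc cd; have := nc ab bc cd dac.
by rewrite del.
Qed.
End Insertion.

(** * From a certificate to a noncrossing order *)

Lemma edge_certificate_sub (V : finType) (e e' : rel V) k :
  subrel e' e -> edge_certificate e k -> edge_certificate e' k.
Proof. by move=> e'e [k1 k2]; split=> // a b x y /e'e ab /e'e xy; exact: k2. Qed.

(** Suppresses a vertex [w] of degree 2. Because of the added edge [xy], no edge separates [x] from
    [y] in the order obtained by induction. *)
Definition bypass_vertex (V : finType) (e : rel V) (w x y : V) : rel V :=
  [rel a b | delete_vertex e w a b || (a == x) && (b == y) || (a == y) && (b == x)].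

(** The edge [xy] stands for the path [x w y], so [certificate_connect] shows that the same [k]
    still works. *)
Lemma edge_certificate_bypass (V : finType) (e : rel V) k w x y :
  symmetric e -> x != w -> y != w -> e w x -> e w y -> edge_certificate e k ->
  edge_certificate (bypass_vertex e w x y) k.
Proof.
move=> e_sym xw yw ewx ewy [k1 k2]; split=> // a b c d.
have ek : edge_certificate e k by split.
have conn u v : bypass_vertex e w x y u v ->
    connect (erestr e [in [:: u; v; w]]) u v.
  move=> /orP[/orP[/and3P[euv _ _]|/andP[/eqP-> /eqP->]]|/andP[/eqP-> /eqP->]].
  - by apply: erestr1 => //=; rewrite !inE eqxx ?orbT.
  - by apply: (@connect_trans _ _ w); apply: erestr1; rewrite ?(e_sym x) //= !inE eqxx ?orbT.
  - by apply: (@connect_trans _ _ w); apply: erestr1; rewrite ?(e_sym y) //= !inE eqxx ?orbT.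
have del u v : delete_vertex e w u v ->
    connect (erestr e [in [:: u; v]]) u v /\ w \notin [:: u; v].
  move=> /and3P[euv uw vw]; split; last by rewrite !inE negb_or !(eq_sym w) uw.
  by apply: erestr1 => //=; rewrite !inE eqxx ?orbT.
move=> ab cd dis.
have [dab|nab] := boolP (delete_vertex e w a b).
  have [cab wab] := del _ _ dab.
  apply: (certificate_connect ek _ cab (conn _ _ cd)) => v /= vab.
  rewrite !inE !negb_or; case/and4P: dis => ac ad bc bd.
  apply/and3P; split; last by apply: contraNneq wab => <-.
    by move: vab; rewrite !inE => /orP[] /eqP ->.
  by move: vab; rewrite !inE => /orP[] /eqP ->.
have [dcd|ncd] := boolP (delete_vertex e w c d).
  have [ccd wcd] := del _ _ dcd.
  apply: (certificate_connect ek _ (conn _ _ ab) ccd) => v /= vab.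
  apply/negP => vcd; case/and4P: dis => ac ad bc bd; move: vab; rewrite !inE.
  case/or3P=> /eqP E; move: vcd; rewrite E.
  - by rewrite !inE (negPf ac) (negPf ad).
  - by rewrite !inE (negPf bc) (negPf bd).
  - by apply/negP.
move: ab cd dis; rewrite /bypass_vertex /= (negPf nab) (negPf ncd) /=.
by move=> /orP[] /andP[/eqP-> /eqP->] /orP[] /andP[/eqP-> /eqP->]; rewrite !eqxx ?andbF.
Qed.

(** Induction by removing a vertex [w] of degree at most 2. If it has two neighbours [x] and [y],
    either there is a gap for [w] on one side of [xy], or [x] and [y] are connected on both sides,
    and with [w] this is a subdivision of [K_{2,3}]. *)
Lemma certificate_noncrossing (V : finType) k n (e : rel V) (S : {set V}) :
  #|S| <= n -> symmetric e -> irreflexive e -> (forall a b, e a b -> a \in S) ->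
  edge_certificate e k ->
  exists2 pos, {in S &, injective pos} & noncrossing e pos.
Proof.
elim: n e S => [|n IH] e S Sn e_sym e_irr eS ek.
  have S0 : S = set0 by apply/eqP; rewrite -cards_eq0 -leqn0.
  exists (fun=> 0) => [a b|a b c d]; last by rewrite ltnn.
  by rewrite S0 inE.
have [S0|[x0 x0S]] := set_0Vmem S.
  by apply: IH => //; rewrite S0 cards0.
have eS' a b : a \in S -> e a b -> b \in S by rewrite e_sym => _ /eS.
have [w wS wdeg] := certificate_degree_le2 e_sym ek e_irr x0S eS'.
have Sw : #|S :\ w| <= n by rewrite (cardsD1 w) wS in Sn.
have dS a b : delete_vertex e w a b -> a \in S :\ w.
  by move=> /and3P[/eS aS aw _]; rewrite !inE aw.
have d_sub : subrel (delete_vertex e w) e by move=> a b /and3P[].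
have d_sym : symmetric (delete_vertex e w).
  by move=> a b; rewrite /delete_vertex /= e_sym [(a != w) && _]andbC.
have [w1|w2] := leqP #|[set y | e w y]| 1.
  have d_irr : irreflexive (delete_vertex e w).
    by move=> a; rewrite /delete_vertex /= e_irr.
  have [pos pos_inj pos_nc] := IH _ _ Sw d_sym d_irr dS (edge_certificate_sub d_sub ek).
  have [x ew] : exists x, forall z, e w z -> z = x.
    have [N0|[x]] := set_0Vmem [set y | e w y].
      by exists w => z ewz; have := in_set0 z; rewrite -N0 inE ewz.
    rewrite inE => ewx; exists x => z ewz.
    by apply: (card_le1_eqP w1); rewrite inE.
  exists (insert_vertex w pos (pos x)); first exact: insert_vertex_inj.
  exact: insert_vertex_noncrossing_pendant.
have /cards2P[x [y [xy NE]]] : #|[set y | e w y]| == 2 by rewrite eqn_leq wdeg.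
have ewE z : e w z = (z == x) || (z == y).
  by have /setP/(_ z) := NE; rewrite !inE.
have ewx : e w x by rewrite ewE eqxx.
have ewy : e w y by rewrite ewE eqxx orbT.
have xw : x != w by apply: contraTneq ewx => ->; rewrite e_irr.
have yw : y != w by apply: contraTneq ewy => ->; rewrite e_irr.
have xS : x \in S :\ w by rewrite !inE xw (eS' w).
have yS : y \in S :\ w by rewrite !inE yw (eS' w).
pose e' := bypass_vertex e w x y.
have e'_sym : symmetric e'.
  move=> a b; rewrite /e' /bypass_vertex /= d_sym -!orbA; congr (_ || _).
  by rewrite orbC [(a == y) && _]andbC [(a == x) && _]andbC.
have e'_irr : irreflexive e'.
  move=> a; rewrite /e' /bypass_vertex /= /delete_vertex /= e_irr /=.
  by case: (eqVneq a x) => [->|_]; rewrite ?(negPf xy) //= andbF.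
have e'S a b : e' a b -> a \in S :\ w.
  by move=> /orP[/orP[/dS //|/andP[/eqP-> _] //]|/andP[/eqP-> _] //].
have [pos0 pos0_inj pos0_nc] := IH _ _ Sw e'_sym e'_irr e'S
  (edge_certificate_bypass e_sym xw yw ewx ewy ek).
have sub' : subrel (delete_vertex e w) e'.
  by move=> a b ab; apply/orP; left; apply/orP; left.
have exy' : e' x y by rewrite /e' /bypass_vertex /= !eqxx orbT.
(* One side of [xy], read from [x] onwards: [w] fits in, or a connection from [x] to [y] runs on
   this side. It is applied to both directions of the cyclic order. *)
have side pos : {in S :\ w &, injective pos} -> noncrossing e' pos ->
    (forall v, pos x <= pos v) ->
    (exists2 pos, {in S &, injective pos} & noncrossing e pos) \/
    pos x < pos y /\
    exists z, [/\ e x z && (z != w), pos x < pos z < pos y &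
      connect (erestr e [pred v | (v != w) && (pos x < pos v <= pos y)]) z y].
  move=> pos_inj nc' x_min.
  have xlty : pos x < pos y.
    rewrite ltn_neqAle x_min andbT; apply: contraNneq xy.
    by move=> /(pos_inj _ _ xS yS) ->.
  have nc : noncrossing (delete_vertex e w) pos.
    move=> a b c d ab bc cd /sub' ac; apply/negP => /sub'.
    by apply/negP; exact: nc' ac.
  have [[z [exz xzy czy]]|[g xgy gap]] :=
    noncrossing_gap d_sym dS pos_inj nc x_min xS yS xlty; last first.
    left; exists (insert_vertex w pos g); first exact: insert_vertex_inj.
    apply: (@insert_vertex_noncrossing _ _ _ _ e_sym nc x y) => // [z|p q].
      by rewrite ewE => /orP[] /eqP; [left | right].
    move=> /sub' pq /andP[xp py].
    by have /andP[] := noncrossing_enclosed e'_sym nc' xp py exy' pq.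
  right; split=> //; exists z; split=> //.
    by case/and3P: exz => -> _ ->.
  apply: connect_sub czy => a b /and3P[/and3P[ab aw bw] Aa Ab].
  by apply: erestr1; rewrite //= ?aw ?bw.
pose pos1 := rotate x pos0; pose pos2 := mirror x pos1.
have nc1 : noncrossing e' pos1 by apply: rotate_noncrossing.
have inj1 : {in S :\ w &, injective pos1} by apply: rotate_inj.
have [//|[xy1 [z1 [/andP[exz1 z1w] /andP[xz1 z1y] c1]]]] := side pos1 inj1 nc1 (rotate_min _ _).
have [||//|[xy2 [z2 [/andP[exz2 z2w] /andP[xz2 z2y] c2]]]] := side pos2 _ _ (mirror_min _ _).
- exact: mirror_inj.
- exact: mirror_noncrossing.
have z2x : pos1 x < pos1 z2.
  have z2S : z2 \in S :\ w by rewrite !inE z2w (eS' x) //; move: xS; rewrite !inE => /andP[].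
  rewrite ltn_neqAle rotate_min andbT; apply: contraTneq exz2.
  by move=> /(inj1 _ _ xS z2S) <-; rewrite e_irr.
have yz2 : pos1 y < pos1 z2 by rewrite -(mirror_lt z2x xy1).
have yz1 : pos2 y < pos2 z1 by rewrite mirror_lt.
(* The middle vertices are [w], [z1] and [z2]; the last two lie on different sides of [xy]. *)
exfalso; apply: (@certificate_no_K23 _ _ _ ek x y w z1 z2 (pred2 w y) _ _ _ _ _ _ _ _ _ _ c1 c2).
- rewrite /= !inE !negb_or !(eq_sym w) z1w z2w yw /=.
  apply/and3P; split=> //; last by apply: contraTneq yz2 => ->; rewrite ltnn.
  apply/andP; split; last by apply: contraTneq z1y => ->; rewrite ltnn.
  by apply: contraTneq yz2 => <-; rewrite -leqNgt ltnW.
- by rewrite e_sym.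
- by [].
- by [].
- split=> /=; rewrite negb_or.
  + by rewrite xw.
  + by rewrite z1w; apply: contraTneq z1y => ->; rewrite ltnn.
  + by rewrite z2w; apply: contraTneq yz2 => ->; rewrite ltnn.
- by rewrite /= eqxx ltnn andbF (leqNgt (pos1 z2)) yz2 !andbF.
- by rewrite /= eqxx ltnn andbF (leqNgt (pos2 z1)) yz1 !andbF.
by apply: erestr1; rewrite //= eqxx ?orbT.
Qed.

(** * Counting disjoint paths *)

Section Ears.
Variables (V : finType) (e : rel V).
Hypotheses (e_sym : symmetric e) (e_irr : irreflexive e).

Definition low_degree : {set V} := [set w | #|[set y | e w y]| <= 2].

(** If [p] has degree at least 3, two of its neighbours lie on the same side of it. The edge to the
    farther one encloses the nearer one, which gives a shorter interval that no edge leaves. *)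
Lemma low_degree_between pos i j p : injective pos -> noncrossing e pos ->
  (forall a b, pos i < pos a < pos j -> e a b -> pos i <= pos b <= pos j) ->
  pos i < pos p < pos j -> exists2 w, w \in low_degree & pos i < pos w < pos j.
Proof.
move=> pos_inj nc; have [m] := ubnP (pos j - pos i).
elim: m i j p => // m IH i j p lt_m encl /andP[ip pj].
have sub i' j' z : pos i <= pos i' -> pos j' <= pos j -> pos j' - pos i' < m ->
    e i' j' -> pos i' < pos z < pos j' ->
    exists2 w, w \in low_degree & pos i < pos w < pos j.
  move=> ii' jj' lt_m' eij z_in.
  have [a b /andP[ia aj] ab|w wl /andP[iw wj]] := IH i' j' z lt_m' _ z_in.
    exact: (noncrossing_enclosed e_sym nc ia aj eij ab).
  by exists w; rewrite ?(leq_ltn_trans ii' iw) ?(leq_trans wj jj').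
have [p_low|p_high] := boolP (p \in low_degree); first by exists p; rewrite ?ip.
pose L := [set y | e p y & pos y < pos p]; pose R := [set y | e p y & pos p < pos y].
have LR : [set y | e p y] = L :|: R.
  apply/setP => y; rewrite !inE -andb_orr -neq_ltn; case: (boolP (e p y)) => //= epy.
  by apply/esym; apply: contraTneq epy => /pos_inj ->; rewrite e_irr.
have : 1 < #|L| \/ 1 < #|R|.
  move: p_high; rewrite inE -ltnNge LR => /leq_trans /(_ (leq_card_setU L R)) /= H.
  by case: (leqP 2 #|L|) => HL; [left | right]; lia.
have pick2 (B : {set V}) : 1 < #|B| -> exists y z, [/\ y \in B, z \in B & pos y < pos z].
  case/card_gt1P=> y [z [yB zB yz]]; have [lt|gt|/pos_inj E] := ltngtP (pos y) (pos z).
  - by exists y, z.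
  - by exists z, y.
  - by rewrite E eqxx in yz.
case=> /pick2[y [z]]; rewrite !inE => -[/andP[epy yp] /andP[epz zp] yz].
  have /andP[iy _] := encl p y ltac:(by rewrite ip) epy.
  apply: (sub y p z) => //; [exact: ltnW | lia | by rewrite e_sym | by rewrite yz].
have /andP[_ zj] := encl p z ltac:(by rewrite ip) epz.
apply: (sub p z y) => //; [exact: ltnW | lia | by rewrite yp].
Qed.

Lemma exists_low_degree pos u : injective pos -> noncrossing e pos -> 2 < #|V| ->
  exists2 w, w \in low_degree & w != u.
Proof.
move=> pos_inj nc V3; pose pos1 := rotate u pos.
have inj1 : injective pos1 by exact: rotate_injective.
have [j _ jmax] := @arg_maxnP _ u xpredT pos1 isT.
have /card_gt0P[p] : 0 < #|[set: V] :\ u :\ j|.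
  move: V3; rewrite -cardsT (cardsD1 u) (cardsD1 j (_ :\ u)).
  by case: (_ \in _); case: (_ \in _); case: #|_|.
rewrite !inE => /and3P[pj pu _].
have [|a b _ _||w wl /andP[uw _]] := @low_degree_between pos1 u j p inj1.
- exact: rotate_noncrossing.
- by rewrite rotate_min; exact: jmax.
- rewrite !ltn_neqAle rotate_min [pos1 p <= _]jmax // !andbT.
  by rewrite (inj_eq inj1) eq_sym pu (inj_eq inj1).
- by exists w => //; apply: contraTneq uw => ->; rewrite ltnn.
Qed.

Lemma low_degree_ge2 pos : injective pos -> noncrossing e pos -> 2 < #|V| ->
  2 <= #|low_degree|.
Proof.
move=> pos_inj nc V3; have /card_gt0P[u _] : 0 < #|V| by apply: leq_trans V3.
have [w wl _] := exists_low_degree u pos_inj nc V3.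
have [w' w'l ww'] := exists_low_degree w pos_inj nc V3.
by apply/card_gt1P; exists w, w'; rewrite eq_sym.
Qed.
End Ears.

(** * Families of disjoint directed paths *)

Section Kappa.
Variable V : finType.
Implicit Types D : {set V * V}.

Definition converse D : {set V * V} := [set uv | (uv.2, uv.1) \in D].

Lemma dipathE D u v p : u != v -> is_dipath D u v p ->
  exists2 s, p = rcons s v & internal u p = s.
Proof.
move=> uv /and3P[_ + _]; case/lastP: p => [|s z]; first by rewrite /= (negPf uv).
by rewrite last_rcons => /eqP ->; exists s; rewrite // /internal belast_rcons.
Qed.

Definition reverse_dipath (u : V) (p : {bseq #|V| of V}) : {bseq #|V| of V} :=
  [bseq of rev (belast u p)].

Lemma kappa_converse D u v : u != v -> kappa D u v <= kappa (converse D) v u.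
Proof.
move=> uv; apply/bigmax_leqP => P /andP[/forall_inP dP /forall_inP disP].
have rP p : p \in P -> exists s, [/\ p = rcons s v :> seq V, internal u p = s &
    reverse_dipath u p = rcons (rev s) u :> seq V].
  move=> /dP dp; have [s ps is_] := dipathE uv dp; exists s; split=> //.
  by rewrite /= ps belast_rcons rev_cons.
have r_inj : {in P &, injective (reverse_dipath u)}.
  move=> p q /rP[s [ps _ rp]] /rP[t [qt _ rq]] E; apply: val_inj => /=.
  by rewrite ps qt; move: rp; rewrite E rq => /rcons_inj[/(can_inj revK) ->].
rewrite -(card_in_imset r_inj); apply: leq_bigmax_cond.
have int p s : rcons (rev s) u = p -> internal v p = rev s.
  by move=> <-; rewrite /internal belast_rcons.
apply/andP; split; apply/forall_inP => _ /imsetP[p pP ->].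
  have [s [ps _ ->]] := rP _ pP; have := dP _ pP; rewrite /is_dipath ps.
  rewrite last_rcons => /and3P[sp _ su]; rewrite last_rcons eqxx /=.
  apply/andP; split; last first.
    by move: su; rewrite -(rev_uniq (u :: _)) rev_cons rev_rcons.
  have := rev_path (fun x y => (x, y) \in converse D) u (rcons s v).
  rewrite last_rcons belast_rcons rev_cons => ->.
  by apply: sub_path sp => x y; rewrite inE.
apply/forall_inP => _ /imsetP[q qP ->]; apply/implyP => pq.
have [s [_ is_ /esym/int ->]] := rP _ pP; have [t [_ it /esym/int ->]] := rP _ qP.
rewrite (eq_disjoint (mem_rev s)) disjoint_sym (eq_disjoint (mem_rev t)) disjoint_sym.
rewrite -is_ -it; apply: (implyP (forall_inP (disP p pP) q qP)).
by apply: contraNneq pq => ->.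
Qed.

Section Family.
Variables (D : {set V * V}) (v u : V) (P : {set {bseq #|V| of V}}).
Hypotheses (vu : v != u) (dP : disjoint_dipaths D v u P).

Lemma family_dipath p : p \in P -> is_dipath D v u p.
Proof. by move=> pP; have /andP[/forall_inP/(_ p pP)] := dP. Qed.

Lemma family_internal_inj p q x : p \in P -> q \in P ->
  x \in internal v p -> x \in internal v q -> p = q.
Proof.
move=> pP qP xp xq; apply/eqP; apply: contraT => pq.
have /andP[_ /forall_inP/(_ p pP)/forall_inP/(_ q qP)/implyP/(_ pq)] := dP.
by move=> /disjointFr/(_ xp); rewrite xq.
Qed.

Lemma dipath_head p : is_dipath D v u p -> (v, head u p) \in D /\
  if head u p == u then p = [:: u] else head u p \in internal v p.
Proof.
move=> dp; have [s ps ip] := dipathE vu dp; rewrite ip; move: dp; rewrite ps.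
case: s {ps ip} => [|z s] /=; first by rewrite eqxx => /and3P[/andP[]].
case/and3P=> /andP[vz _] _ /and3P[_]; rewrite mem_rcons inE negb_or => /andP[zu _] _.
by rewrite (negPf zu) mem_head.
Qed.

(** A common first vertex is internal to both paths, unless it is [u]; then both are the single arc
    from [v] to [u]. *)
Lemma family_head_inj : {in P &, injective (fun p : {bseq #|V| of V} => head u p)}.
Proof.
move=> p q pP qP pq.
have [_] := dipath_head (family_dipath pP); have [_] := dipath_head (family_dipath qP).
rewrite pq; case: ifP => [_ qE pE|_ hq hp]; first by apply: val_inj; rewrite /= pE qE.
exact: family_internal_inj hp hq.
Qed.
End Family.

Lemma kappa_outdegree D u v : u != v -> kappa D u v <= #|[set z | (u, z) \in D]|.
Proof.
move=> uv; apply/bigmax_leqP => P dP; rewrite -(card_in_imset (family_head_inj uv dP)).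
apply/subset_leq_card/subsetP => _ /imsetP[p pP ->].
by rewrite inE; have [] := dipath_head uv (family_dipath dP pP).
Qed.

Lemma kappa_indegree D u v : u != v -> kappa D u v <= #|[set z | (z, v) \in D]|.
Proof.
move=> uv; apply: leq_trans (kappa_converse D uv) _.
apply: leq_trans (kappa_outdegree _ _) _; first by rewrite eq_sym.
by apply: subset_leq_card; apply/subsetP => z; rewrite !inE.
Qed.
End Kappa.

(** * Paths on the two sides of a vertex *)

Section Sides.
Variables (V : finType) (e : rel V).
Hypotheses (e_sym : symmetric e) (e_irr : irreflexive e).
Implicit Types (D : {set V * V}) (pos : V -> nat).

(** Edges from vertices strictly under [xv] stay between [x] and [v], so a walk that avoids [v] can
    get out only through [x]. *)
Lemma path_exits pos x v z s : injective pos -> noncrossing e pos -> e x v ->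
  path e z s -> pos x <= pos z < pos v -> ~~ (pos x <= pos (last z s) < pos v) ->
  v \notin z :: s -> x \in z :: s.
Proof.
move=> pos_inj nc exv; elim: s z => [|z1 s IH] z /=; first by move=> _ ->.
case/andP=> zz1 z1s /andP[xz zv] out; rewrite in_cons negb_or => /andP[_ vs].
have [->|zx] := eqVneq z x; first exact: mem_head.
have xz' : pos x < pos z.
  by rewrite ltn_neqAle xz andbT; apply: contraNneq zx => /pos_inj ->.
have /andP[xz1 z1v] := noncrossing_enclosed e_sym nc xz' zv exv zz1.
rewrite in_cons IH ?orbT // xz1 ltn_neqAle z1v andbT.
by apply: contraNneq vs => /pos_inj ->; exact: mem_head.
Qed.

Definition left_out D pos (u v : V) : bool :=
  [exists z, ((v, z) \in D) && (pos u < pos z < pos v)].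

Definition right_out D pos (v : V) : bool :=
  [exists z, ((v, z) \in D) && (pos v < pos z)].

(* Let [x] be the leftmost neighbour of [v] other than the first vertex [u]. By
   noncrossing, a path from [v] to [u] that starts to the left of [v] meets [x]. *)
Lemma left_family_card D pos u v P : injective pos -> noncrossing e pos ->
  (forall a b, (a, b) \in D -> e a b) -> v != u -> disjoint_dipaths D v u P ->
  #|[set p in P | pos u < pos (head u p) < pos v]| <= left_out D pos u v.
Proof.
move=> pos_inj nc De vu dP.
have [/existsP[z0 /andP[vz0 uz0v]]|/existsPn no_left] := boolP (left_out D pos u v); last first.
  rewrite leqn0 cards_eq0; apply/eqP/setP => p; rewrite !inE; apply/negP.
  case/andP=> pP hp; have := no_left (head u p); rewrite hp andbT.
  by have [-> _] := dipath_head vu (family_dipath dP pP).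
have z0_left : e v z0 && (pos u < pos z0 < pos v) by rewrite De.
have [x /andP[evx /andP[ux xv]] xmin] :=
  @arg_minnP _ z0 (fun z => e v z && (pos u < pos z < pos v)) pos z0_left.
apply/card_le1_eqP.
suff x_int p : p \in P -> pos u < pos (head u p) < pos v -> x \in internal v p.
  move=> p q; rewrite !inE => /andP[pP hp] /andP[qP hq].
  exact: (family_internal_inj dP qP pP (x_int q qP hq) (x_int p pP hp)).
move=> pP hp; have dp := family_dipath dP pP; have [s ps ->] := dipathE vu dp.
move: dp hp; rewrite ps => /and3P[pD _ /andP[]].
case: s {ps} pD => [|z s] /= /andP[vz zs] v_s _ /andP[uz zv]; first by rewrite ltnn in uz.
suff : x \in z :: rcons s u.
  by rewrite -rcons_cons mem_rcons inE => /orP[/eqP xu|//]; rewrite xu ltnn in ux.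
apply: (@path_exits pos _ v) => //; rewrite ?(e_sym x) //.
- by apply: sub_path zs => a b; exact: De.
- by rewrite zv andbT; apply: xmin; rewrite uz zv De.
- by rewrite last_rcons leqNgt ux.
Qed.

(** The paths are sorted by their first vertex: [u] itself, left of [v] or right of [v]. Each class
    has at most one path; the right one is the left one of the mirrored order. *)
Lemma kappa_side D pos u v : injective pos -> noncrossing e pos ->
  (forall w, pos u <= pos w) -> (forall a b, (a, b) \in D -> e a b) -> v != u ->
  kappa D v u <= ((v, u) \in D) + left_out D pos u v + right_out D pos v.
Proof.
move=> pos_inj nc u_min De vu; apply/bigmax_leqP => P dP.
have lt_u w : w != u -> pos u < pos w.
  by move=> wu; rewrite ltn_neqAle u_min andbT (inj_eq pos_inj) eq_sym.
pose pos2 := mirror u pos.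
have inj2 : injective pos2 by exact: mirror_injective.
have mid : #|[set p in P | head u p == u]| <= ((v, u) \in D).
  have [vuD|vuD] := boolP ((v, u) \in D).
    apply/card_le1_eqP => p q; rewrite !inE => /andP[pP /eqP hp] /andP[qP /eqP hq].
    by apply: (family_head_inj vu dP) => //; rewrite hp hq.
  rewrite leqn0 cards_eq0; apply/eqP/setP => p; rewrite !inE; apply/negP.
  case/andP=> pP /eqP hp; have [] := dipath_head vu (family_dipath dP pP).
  by rewrite hp (negPf vuD).
have left_ := left_family_card pos_inj nc De vu dP.
have right_ := left_family_card inj2 (mirror_noncrossing e_sym nc) De vu dP.
have pos2_lt w : w != u -> pos2 u < pos2 w.
  by move=> wu; rewrite ltn_neqAle mirror_min andbT (inj_eq inj2) eq_sym.
have right_outE : left_out D pos2 u v <= right_out D pos v.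
  case: (boolP (left_out _ _ _ _)) => [/existsP[z /and3P[vz uz zv]]|//].
  rewrite lt0b; apply/existsP; exists z; rewrite vz -(mirror_lt (u := u)) ?lt_u //.
  by apply: contraTneq uz => ->; rewrite ltnn.
apply: leq_trans (leq_add (leq_add mid left_) (leq_trans right_ right_outE)).
have PE : P \subset [set p in P | head u p == u] :|:
    [set p in P | pos u < pos (head u p) < pos v] :|:
    [set p in P | pos2 u < pos2 (head u p) < pos2 v].
  apply/subsetP => p pP; rewrite !inE pP /=; case: eqVneq => //= hu.
  rewrite lt_u // pos2_lt // mirror_lt ?lt_u //= -neq_ltn (inj_eq pos_inj).
  apply: contraTneq (family_dipath dP pP) => hv.
  have [+ _] := dipath_head vu (family_dipath dP pP).
  by rewrite hv => /De; rewrite e_irr.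
apply: leq_trans (subset_leq_card PE) _.
apply: leq_trans (leq_card_setU _ _) _; rewrite leq_add2r.
exact: leq_card_setU.
Qed.
End Sides.

Section Excess.
Variables (V : finType) (e : rel V) (D : {set V * V}).
Hypotheses (e_sym : symmetric e) (e_irr : irreflexive e).
Hypothesis D_or : is_orientation e D.
Implicit Types pos : V -> nat.

Lemma orientation_edge a b : (a, b) \in D -> e a b.
Proof.
move=> ab; have /forallP/(_ a)/forallP/(_ b) := D_or.
by case: ifP => // _; rewrite ab.
Qed.

Lemma orientation_xor a b : e a b -> ((a, b) \in D) (+) ((b, a) \in D).
Proof. by move=> eab; have /forallP/(_ a)/forallP/(_ b) := D_or; rewrite eab. Qed.

Definition kappa2 (u v : V) : nat := kappa D u v + kappa D v u.

Lemma kappa2C u v : kappa2 u v = kappa2 v u.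
Proof. exact: addnC. Qed.

(** The out-degree of [u] bounds one term and its in-degree the other. *)
Lemma kappa2_degree u v : u != v -> kappa2 u v <= #|[set y | e u y]|.
Proof.
move=> uv; apply: leq_trans (leq_add (kappa_outdegree D uv) (kappa_indegree D _)) _.
  by rewrite eq_sym.
rewrite -cardsUI (_ : _ :&: _ = set0) ?cards0 ?addn0.
  apply: subset_leq_card; apply/subsetP => z; rewrite !inE => /orP[]/orientation_edge //.
  by rewrite e_sym.
apply/setP => z; rewrite !inE; apply/negP => /andP[uz zu].
by have := orientation_xor (orientation_edge uz); rewrite uz zu.
Qed.

Definition left_both pos u v : bool :=
  left_out D pos u v && left_out (converse D) pos u v.

Definition right_both pos v : bool :=
  right_out D pos v && right_out (converse D) pos v.

(** This adds [kappa_side] for [D] and for its converse; the edge [uv] counts once, being directed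
    in one way only. *)
Lemma kappa2_sides pos u v : injective pos -> noncrossing e pos ->
  (forall w, pos u <= pos w) -> v != u ->
  kappa2 u v <= e u v + (left_out D pos u v + left_out (converse D) pos u v)
                + (right_out D pos v + right_out (converse D) pos v).
Proof.
move=> pos_inj nc u_min vu.
have convE a b : (a, b) \in converse D -> e a b.
  by rewrite inE e_sym => /orientation_edge.
have H1 := kappa_side e_sym e_irr pos_inj nc u_min orientation_edge vu.
have H2 : kappa D u v <= kappa (converse D) v u by apply: kappa_converse; rewrite eq_sym.
have H3 := kappa_side e_sym e_irr pos_inj nc u_min convE vu.
have H4 : ((u, v) \in D) + ((v, u) \in D) <= e u v.
  case: (boolP (e u v)) => [/orientation_xor|/negP euv].
    by case: (_ \in D); case: (_ \in D).
  have -> : (u, v) \in D = false by apply/negP => /orientation_edge.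
  by have -> : (v, u) \in D = false by apply/negP => /orientation_edge; rewrite e_sym.
have E : ((v, u) \in converse D) = ((u, v) \in D) by rewrite inE.
rewrite E in H3; move: H1 H2 H3 H4; rewrite /kappa2; clear.
move: (kappa _ _ _) (kappa _ _ _) (kappa _ _ _).
move: (nat_of_bool _) (nat_of_bool _) (nat_of_bool _).
move: (nat_of_bool _) (nat_of_bool _) (nat_of_bool _) (nat_of_bool _).
lia.
Qed.
End Excess.

(** * Counting the excess over 3 *)

Section Counting.
Variables (V : finType) (e : rel V) (D : {set V * V}).
Hypotheses (e_sym : symmetric e) (e_irr : irreflexive e).
Hypothesis D_or : is_orientation e D.
Implicit Types pos : V -> nat.

Lemma two_sided_neighbours pos v z1 z2 : injective pos ->
  (v, z1) \in D -> (v, z2) \in converse D ->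
  [/\ e v z1, e v z2 & pos z1 < pos z2 \/ pos z2 < pos z1].
Proof.
rewrite inE /= => pos_inj vz1 z2v; have ev := orientation_edge D_or vz1.
split=> //; first by rewrite e_sym (orientation_edge D_or).
apply/orP; rewrite -neq_ltn; apply/negP => /eqP /pos_inj E; subst z2.
by have := orientation_xor D_or ev; rewrite vz1 z2v.
Qed.

(** An out-neighbour and an in-neighbour are distinct, so the edge to the farther one encloses the
    nearer one and [low_degree_between] applies. *)
Lemma right_both_low_degree pos v : injective pos -> noncrossing e pos ->
  right_both D pos v ->
  exists y w, [/\ e v y, w \in low_degree e, pos v < pos w & pos w < pos y].
Proof.
move=> pos_inj nc /andP[/existsP[z1 /andP[D1 vz1]] /existsP[z2 /andP[D2 vz2]]].
have [e1 e2] := two_sided_neighbours pos_inj D1 D2.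
have H y z : e v y -> pos v < pos z -> pos z < pos y ->
    exists y w, [/\ e v y, w \in low_degree e, pos v < pos w & pos w < pos y].
  move=> evy vz zy; have [a b /andP[va ay] ab||w wl /andP[vw wy]] :=
    @low_degree_between _ _ e_sym e_irr pos v y z pos_inj nc.
  - exact: (noncrossing_enclosed e_sym nc va ay evy ab).
  - by rewrite vz.
  - by exists y, w.
by case=> lt; [apply: (H z2 z1) | apply: (H z1 z2)].
Qed.

Lemma left_both_low_degree pos u v : injective pos -> noncrossing e pos ->
  left_both D pos u v ->
  exists x w, [/\ e x v, w \in low_degree e, pos x < pos w & pos w < pos v].
Proof.
move=> pos_inj nc /andP[/existsP[z1 /and3P[D1 _ vz1]] /existsP[z2 /and3P[D2 _ vz2]]].
have [e1 e2] := two_sided_neighbours pos_inj D1 D2.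
have H y z : e v y -> pos z < pos v -> pos y < pos z ->
    exists x w, [/\ e x v, w \in low_degree e, pos x < pos w & pos w < pos v].
  rewrite e_sym => evy vz zy; have [a b /andP[va ay] ab||w wl /andP[vw wy]] :=
    @low_degree_between _ _ e_sym e_irr pos y v z pos_inj nc.
  - exact: (noncrossing_enclosed e_sym nc va ay evy ab).
  - by rewrite zy.
  - by exists y, w.
by case=> lt; [apply: (H z1 z2) | apply: (H z2 z1)].
Qed.

(* The first vertex of degree at most 2 to the right of [v] determines [v]. *)
Lemma card_right_both pos u : injective pos -> noncrossing e pos ->
  (forall w, pos u <= pos w) ->
  #|[set v | [&& v != u, 3 < kappa2 D u v & right_both D pos v]]| <= #|low_degree e|.
Proof.
move=> pos_inj nc u_min; set X := [set v | _].
have /fin_all_exists[f fP] v : exists w, v \in X -> [/\ w \in low_degree e, pos v < pos w &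
    forall w', w' \in low_degree e -> pos v < pos w' -> pos w <= pos w'].
  have [vX|_] := boolP (v \in X); last by exists v.
  have [y [w [_ wl vw _]]] : exists y w,
      [/\ e v y, w \in low_degree e, pos v < pos w & pos w < pos y].
    by move: vX; rewrite inE => /and3P[_ _]; exact: right_both_low_degree.
  have wP : (w \in low_degree e) && (pos v < pos w) by rewrite wl.
  have [m /andP[ml vm] mmin] :=
    @arg_minnP _ w (fun w => (w \in low_degree e) && (pos v < pos w)) pos wP.
  by exists m => _; split=> // w' w'l vw'; apply: mmin; rewrite w'l.
(* If [f v = f v'], then [v'] lies under an edge [vy]. Hence it is not adjacent to [u], and as its
   [kappa2] exceeds 3 it has in- and out-neighbours on its left too. Under these hides a vertex of
   degree at most 2 between [v] and [v'], before [f v]. *)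
have f_lt v v' : v \in X -> v' \in X -> pos v < pos v' -> f v != f v'.
  move=> vX v'X vv'; apply/negP => /eqP fvv'.
  have [wl vw wmin] := fP v vX; have [_ v'w _] := fP v' v'X; rewrite -fvv' in v'w.
  move: (vX) (v'X); rewrite !inE => /and3P[vu _ vr] /and3P[v'u k4 v'r].
  have [y [w' [evy w'l vw' w'y]]] := right_both_low_degree pos_inj nc vr.
  have v'y : pos v' < pos y.
    exact: ltn_trans v'w (leq_ltn_trans (wmin _ w'l vw') w'y).
  have uv : pos u < pos v.
    by rewrite ltn_neqAle u_min andbT (inj_eq pos_inj) eq_sym.
  have nuv' : ~~ e u v'.
    rewrite e_sym; apply/negP => ev'u.
    have /andP[] := noncrossing_enclosed e_sym nc vv' v'y evy ev'u.
    by rewrite leqNgt uv.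
  have v'l : left_both D pos u v'.
    have := kappa2_sides e_sym e_irr D_or pos_inj nc u_min v'u.
    rewrite (negPf nuv') /left_both add0n => /(leq_trans k4).
    by do 4!case: (_ _ _ _).
  have [x [w2 [exv' w2l xw2 w2v']]] := left_both_low_degree pos_inj nc v'l.
  have /andP[vx _] : pos v <= pos x <= pos y.
    by apply: (noncrossing_enclosed e_sym nc vv' v'y evy); rewrite e_sym.
  have := wmin _ w2l (leq_ltn_trans vx xw2).
  by rewrite leqNgt (ltn_trans w2v' v'w).
have f_inj : {in X &, injective f}.
  move=> v v' vX v'X E; have [lt|lt|/pos_inj//] := ltngtP (pos v) (pos v').
    by have := f_lt _ _ vX v'X lt; rewrite E eqxx.
  by have := f_lt _ _ v'X vX lt; rewrite E eqxx.
rewrite -(card_in_imset f_inj); apply/subset_leq_card/subsetP => _ /imsetP[v vX ->].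
by have [] := fP v vX.
Qed.

(** The excess of a pair is at most the number of sides on which [v] has both an in- and an
    out-neighbour; [card_right_both] counts each side, the left one in the mirrored order. *)
Lemma sum_excess pos u : injective pos -> noncrossing e pos ->
  \sum_(v | v != u) (kappa2 D u v - 3) <= 2 * #|low_degree e|.
Proof.
move=> inj0 nc0; pose pos1 := rotate u pos; pose pos2 := mirror u pos1.
have inj1 : injective pos1 by exact: rotate_injective.
have inj2 : injective pos2 by exact: mirror_injective.
have nc1 : noncrossing e pos1 by exact: rotate_noncrossing.
have nc2 : noncrossing e pos2 by exact: mirror_noncrossing.
have min1 : forall w, pos1 u <= pos1 w by exact: rotate_min.
have R1 := card_right_both inj1 nc1 min1.
have R2 := card_right_both inj2 nc2 (mirror_min u pos1).
rewrite mul2n -addnn; apply: leq_trans (leq_add R1 R2).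
have cardE (Q : pred V) : #|[set v | (v != u) && Q v]| = \sum_(v | v != u) Q v.
  rewrite -sum1dep_card big_mkcondr; apply: eq_bigr => v _; by case: (Q v).
rewrite !cardE -big_split; apply: leq_sum => v vu /=.
have lt_u w : w != u -> pos1 u < pos1 w.
  by move=> wu; rewrite ltn_neqAle min1 andbT (inj_eq inj1) eq_sym.
have left_right D' : left_out D' pos1 u v -> right_out D' pos2 v.
  case/existsP=> z /and3P[vz uz zv]; apply/existsP; exists z.
  by rewrite vz mirror_lt // lt_u.
have := kappa2_sides e_sym e_irr D_or inj1 nc1 min1 vu; rewrite /right_both.
have := left_right D; have := left_right (converse D).
move: (kappa2 D u v) => k.
case: (left_out D _ _ _); case: (left_out (converse D) _ _ _);
  case: (right_out D pos1 _); case: (right_out (converse D) pos1 _);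
  case: (right_out D pos2 _); case: (right_out (converse D) pos2 _);
  case: (e u v) => /= H1 H2 H3;
  by [have := H1 isT | have := H2 isT | case: ltnP => H4; clear -H3 H4; lia].
Qed.

(** With [n] vertices, [a] of them in [A]: a vertex in [A] contributes at most [2(n-1)]. One outside
    saves 1 on each pair with [A] and has excess at most [2a], so it contributes at most
    [3(n-1) + a]. Then [2a(n-1) + (n-a)(3(n-1) + a) = 3n(n-1) - a(a-1)]. *)
Lemma sum_kappa2 pos : injective pos -> noncrossing e pos ->
  \sum_u \sum_(v | v != u) kappa2 D u v
    + #|low_degree e| ^ 2 <= 3 * (#|V| * #|V|.-1) + #|low_degree e|.
Proof.
move=> pos_inj nc; set A := low_degree e.
have A2 u v : v != u -> (u \in A) || (v \in A) -> kappa2 D u v <= 2.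
  move=> vu /orP[]; rewrite inE => le2.
    by apply: leq_trans le2; apply: kappa2_degree; rewrite // eq_sym.
  by rewrite kappa2C; apply: leq_trans le2; exact: kappa2_degree.
have cardN (u : V) c : \sum_(v | v != u) c = c * #|V|.-1.
  by rewrite sum_nat_const mulnC; congr (_ * _); exact: cardC1.
have in_A u : u \in A -> \sum_(v | v != u) kappa2 D u v <= 2 * #|V|.-1.
  by move=> uA; rewrite -(cardN u); apply: leq_sum => v vu; rewrite A2 // uA.
have out_A u : u \notin A -> \sum_(v | v != u) kappa2 D u v <= 3 * #|V|.-1 + #|A|.
  move=> uA.
  have AE : #|A| = \sum_(v | v != u) (v \in A).
    rewrite -sum1_card [RHS]big_mkcond /= [LHS]big_mkcond /=; apply: eq_bigr => v _.
    by case: eqVneq => [->|_]; [rewrite (negPf uA) | case: (v \in A)].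
  have le : \sum_(v | v != u) kappa2 D u v + #|A|
      <= 3 * #|V|.-1 + \sum_(v | v != u) (kappa2 D u v - 3).
    rewrite AE -(cardN u) -!big_split; apply: leq_sum => v vu /=.
    case: (boolP (v \in A)) => vA; last by rewrite addn0 -maxnE leq_maxr.
    by rewrite addn1; apply: leq_trans (leq_addr _ _); rewrite ltnS A2 // vA orbT.
  have ex := sum_excess u pos_inj nc.
  move: le ex; rewrite -/A; clear; lia.
have AV : #|A| <= #|V| by apply: max_card.
have total : \sum_u \sum_(v | v != u) kappa2 D u v
    <= #|A| * (2 * #|V|.-1) + (#|V| - #|A|) * (3 * #|V|.-1 + #|A|).
  rewrite (bigID (mem A)) /=; apply: leq_add.
    by rewrite -sum_nat_const; apply: leq_sum => u; exact: in_A.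
  have -> : #|V| - #|A| = #|[predC A]| by rewrite -(cardC (mem A)) addKn.
  by rewrite -sum_nat_const; apply: leq_sum => u; exact: out_A.
move: total AV; move: (\sum_u _) #|A| => t a; case: #|V| => [|m] /=; clear; first nia.
move=> total am; have [c E] : exists c, m.+1 = a + c by exists (m.+1 - a); lia.
have Ea : a * m + a = a * a + a * c by rewrite -mulnSr E mulnDr.
move: total; rewrite E addKn -mulnn; nia.
Qed.
End Counting.

(** What is needed is [a(a-1) >= 10 - 2n]. For [n >= 4] this follows from [a >= 2]; for [n = 3] all
    three vertices have degree at most 2, so [a(a-1) = 6]. *)
Lemma sum_kappa_le (V : finType) (e : rel V) (D : {set V * V}) (pos : V -> nat) :
  symmetric e -> irreflexive e -> is_orientation e D -> injective pos ->
  noncrossing e pos -> (3 <= #|V|)%N ->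
  (2 * \sum_(uv : V * V | uv.1 != uv.2) kappa D uv.1 uv.2 + 10
    <= 3 * (#|V| * #|V|.-1) + 2 * #|V|)%N.
Proof.
move=> e_sym e_irr D_or pos_inj nc V3.
have sumE (F : V -> V -> nat) : (\sum_(uv : V * V | uv.1 != uv.2) F uv.1 uv.2
    = \sum_u \sum_(v | v != u) F u v)%N.
  rewrite pair_big_dep /=; by apply: eq_bigl => -[u v] /=; rewrite eq_sym.
have sumC : (\sum_u \sum_(v | v != u) kappa D v u
    = \sum_u \sum_(v | v != u) kappa D u v)%N.
  rewrite (exchange_big_dep xpredT) //=; apply: eq_bigr => u _.
  by apply: eq_bigl => v; rewrite eq_sym.
have -> : (2 * \sum_(uv : V * V | uv.1 != uv.2) kappa D uv.1 uv.2
    = \sum_u \sum_(v | v != u) kappa2 D u v)%N.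
  rewrite sumE mul2n -addnn -{2}sumC -big_split; apply: eq_bigr => u _.
  by rewrite -big_split.
have total := sum_kappa2 e_sym e_irr D_or pos_inj nc.
have low2 := low_degree_ge2 e_sym e_irr pos_inj nc V3.
have low3 : #|V| = 3%N -> #|low_degree e| = 3%N.
  move=> V3'; rewrite -V3' -cardsT; congr #|pred_of_set _|; apply/setP => w; rewrite !inE.
  have <- : #|predC1 w| = 2%N by rewrite cardC1 V3'.
  apply: subset_leq_card; apply/subsetP => y; rewrite !inE.
  by apply: contraTneq => ->; rewrite e_irr.
move: total low2 low3 V3; move: (\sum_u _)%N #|low_degree e| #|V| => t a n; clear.
have [->|n3] := eqVneq n 3%N => total low2 low3 V3; first by rewrite low3 // in total; lia.
rewrite -mulnn in total; have : (2 * a <= a * a)%N by rewrite leq_mul2r low2 orbT.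
move=> aa; lia.
Qed.

(** * Certificates from plane drawings *)

From mathcomp Require Import all_classical all_reals all_analysis.
From mathcomp Require Import ring lra.

Import numFieldNormedType.Exports.

Local Open Scope ring_scope.

(** * Quadrants and discrete rotation *)

Definition opposite (a b : nat) : bool := b == ((a + 2) %% 4)%N.

(* Quadrants are numbered counterclockwise by 0..3; the value 0 on opposite
   quadrants is junk. *)
Definition qstep (a b : nat) : int :=
  if b == ((a + 1) %% 4)%N then 1 else if a == ((b + 1) %% 4)%N then -1 else 0.

Definition turn (q : nat -> nat) (n : nat) : int :=
  \sum_(i < n) qstep (q i) (q i.+1).

Lemma qstepxx a : qstep a a = 0.
Proof. by rewrite /qstep; do ! case: eqP; lia. Qed.

Lemma qstep_opposite a b : (a < 4)%N -> (b < 4)%N ->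
  qstep ((a + 2) %% 4) ((b + 2) %% 4) = qstep a b.
Proof. by case: a => [|[|[|[|a]]]] //; case: b => [|[|[|[|b]]]] //. Qed.

Lemma qstep_mod a b : (a < 4)%N -> (b < 4)%N -> ~~ opposite a b ->
  exists c : int, b%:Z = a%:Z + qstep a b + 4 * c.
Proof.
case: a => [|[|[|[|a]]]] //; case: b => [|[|[|[|b]]]] // => //= _ _ _;
  rewrite /qstep /=; by [exists 0 | exists (-1) | exists 1].
Qed.

Lemma qstep_add a b c : (a < 4)%N -> (b < 4)%N -> (c < 4)%N ->
  ~~ opposite a b -> ~~ opposite b c -> ~~ opposite a c ->
  qstep a b + qstep b c = qstep a c.
Proof.
by case: a => [|[|[|[|a]]]] //; case: b => [|[|[|[|b]]]] //; case: c => [|[|[|[|c]]]] //.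
Qed.

Lemma turnS q n : turn q n.+1 = turn q n + qstep (q n) (q n.+1).
Proof. by rewrite /turn big_ord_recr. Qed.

Lemma eq_turn q r n : (forall i, (i <= n)%N -> q i = r i) -> turn q n = turn r n.
Proof. by move=> qr; apply: eq_bigr => i _; rewrite !qr // ltnW. Qed.

Lemma turn_opposite q n : (forall i, (q i < 4)%N) ->
  turn (fun i => (q i + 2) %% 4)%N n = turn q n.
Proof. by move=> q4; apply: eq_bigr => i _; rewrite qstep_opposite. Qed.

Lemma turn_const q n : (forall i, (q i < 4)%N) ->
  (forall i j, (i <= n)%N -> (j <= n)%N -> ~~ opposite (q i) (q j)) ->
  turn q n = qstep (q 0%N) (q n).
Proof.
move=> q4; elim: n => [|n IH] qn; first by rewrite /turn big_ord0 qstepxx.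
rewrite turnS IH => [|i j i_n j_n]; last by apply: qn; lia.
by rewrite qstep_add // qn.
Qed.

(** Between consecutive indices both ways around the small square agree by [qstep_add]; the sum
    telescopes. *)
Lemma turn_parallel q r n : (forall i, (q i < 4)%N) -> (forall i, (r i < 4)%N) ->
  (forall i j, (i <= n)%N -> (i <= j <= i.+1)%N -> (j <= n)%N ->
     [/\ ~~ opposite (q i) (q j), ~~ opposite (r i) (r j)
       & ~~ opposite (q i) (r j)]) ->
  turn r n - turn q n = qstep (q n) (r n) - qstep (q 0%N) (r 0%N).
Proof.
move=> q4 r4; elim: n => [|n IH] qr; first by rewrite /turn !big_ord0 !subrr.
have {}IH: turn r n - turn q n = qstep (q n) (r n) - qstep (q 0%N) (r 0%N).
  by apply: IH => i j *; apply: qr; lia.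
rewrite !turnS.
have [|||_ _ H1] := qr n n; try lia.
have [|||H2 H3 H4] := qr n n.+1; try lia.
have [|||_ _ H5] := qr n.+1 n.+1; try lia.
have E1 := qstep_add (q4 n) (q4 n.+1) (r4 n.+1) H2 H5 H4.
have E2 := qstep_add (q4 n) (r4 n) (r4 n.+1) H1 H3 H4.
lia.
Qed.

(** A discrete homotopy: no cell of the grid has winding, hence neither does its boundary. *)
Lemma turn_square (G : nat -> nat -> nat) n : (forall i j, (G i j < 4)%N) ->
  (forall i j i' j', (i <= n)%N -> (j <= n)%N -> (i' <= n)%N -> (j' <= n)%N ->
     (i <= i' <= i.+1)%N -> (j <= j' <= j.+1)%N -> ~~ opposite (G i j) (G i' j')) ->
  turn (G n) n - turn (G 0%N) n = turn (G^~ n) n - turn (G^~ 0%N) n.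
Proof.
move=> G4 Gn.
suff H m : (m <= n)%N ->
    turn (G m) n - turn (G 0%N) n = turn (G^~ n) m - turn (G^~ 0%N) m.
  exact: H.
elim: m => [|m IH] m_n; first by rewrite /turn !big_ord0 !subrr.
have {}IH := IH (ltnW m_n).
have E := @turn_parallel (G m) (G m.+1) n (G4 _) (G4 _) _.
rewrite !turnS.
have E' : turn (G m.+1) n - turn (G m) n
          = qstep (G m n) (G m.+1 n) - qstep (G m 0%N) (G m.+1 0%N).
  by apply: E => i j *; split; apply: Gn; lia.
lia.
Qed.

Section Quadrants.
Variable R : realType.
Implicit Types z w : R * R.

(* [quad 0 = 3] is junk. *)
Definition quad z : nat :=
  if (0 < z.1) && (0 <= z.2) then 0%N
  else if (z.1 <= 0) && (0 < z.2) then 1%N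
  else if (z.1 < 0) && (z.2 <= 0) then 2%N else 3%N.

Lemma quad_lt4 z : (quad z < 4)%N.
Proof. by rewrite /quad; do ! case: ifP. Qed.

Lemma quadN z : z != 0 -> quad (- z) = ((quad z + 2) %% 4)%N.
Proof.
case: z => x y; rewrite /quad /= !oppr_gt0 !oppr_ge0 !oppr_lt0 !oppr_le0.
by case: (ltgtP x 0) => [_|_|->]; case: (ltgtP y 0) => [_|_|->] //=; rewrite ?eqxx.
Qed.

Lemma le_norm_opposite_sign (x a : R) : x * a <= 0 -> `|x| <= `|x - a|.
Proof.
move=> xa; rewrite -ler_sqr ?nnegrE // -!normrX !ger0_norm ?sqr_ge0 //.
by have := sqr_ge0 a; rewrite !expr2; nra.
Qed.

(** In opposite quadrants corresponding coordinates have products at most 0, so no coordinate of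
    [z - w] is smaller in absolute value than that of [z]; the norm is the maximum norm. *)
Lemma near_quad z w : `|z - w| < `|z| -> ~~ opposite (quad z) (quad w).
Proof.
apply: contraTN => zw; rewrite -leNgt.
suff [H1 H2] : z.1 * w.1 <= 0 /\ z.2 * w.2 <= 0.
  by rewrite !prod_normE /= ge_max !le_max !le_norm_opposite_sign ?orbT.
move: zw; case: z w => [x y] [a b]; rewrite /quad /=.
by case: (ltgtP x 0) => [?|?|->]; case: (ltgtP y 0) => [?|?|->] //=;
   case: (ltgtP a 0) => [?|?|->]; case: (ltgtP b 0) => [?|?|->] //= _;
   split; nra.
Qed.
End Quadrants.

Local Open Scope classical_set_scope.
Local Open Scope ring_scope.

(** * Separation and sampling of arcs *)

Section Arcs.
Variable R : realType.
Implicit Types f g : R -> R * R.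

Lemma compact_pos_lb (T : topologicalType) (A : set T) (h : T -> R) :
  compact A -> continuous h -> (forall x, A x -> 0 < h x) ->
  exists2 m, 0 < m & forall x, A x -> m <= h x.
Proof.
move=> Ac hc h0; have [->|/set0P A0] := eqVneq A set0; first by exists 1.
have [|c cA cm] := compact_EVT_min A0 Ac _ (f := h).
  exact: continuous_subspaceT.
exists (h c); first by apply: h0; rewrite inE in cA.
by move=> x Ax; apply: cm; rewrite inE.
Qed.

Lemma dist_continuous (T U : topologicalType) (W : normedModType R)
    (f : T -> W) (g : U -> W) : continuous f -> continuous g ->
  continuous (fun st : T * U => `|f st.1 - g st.2|).
Proof.
move=> fc gc x; apply: cvg_norm; apply: cvgB.
  by apply: (@cvg_comp _ _ _ fst f); [exact: cvg_fst | exact: fc].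
by apply: (@cvg_comp _ _ _ snd g); [exact: cvg_snd | exact: gc].
Qed.

Lemma compact_unit_square : compact (([set` `[0, 1]] `*` [set` `[0, 1]]) : set (R * R)).
Proof. by apply: compact_setX; apply: segment_compact. Qed.

Lemma arcs_separated f g : continuous f -> continuous g ->
  (forall s t, 0 <= s <= 1 -> 0 <= t <= 1 -> f s != g t) ->
  \forall m \near 0^'+, forall s t, 0 <= s <= 1 -> 0 <= t <= 1 ->
     m <= `|f s - g t|.
Proof.
move=> fc gc fg; have hc := dist_continuous fc gc.
have [|m m0 hm] := compact_pos_lb compact_unit_square hc.
  by move=> [s t] /= []; rewrite !in_itv /= => s01 t01; rewrite normr_gt0 subr_eq0 fg.
near=> d => s t s01 t01; apply: (@le_trans _ _ m).
  by near: d; apply: nbhs_right_le.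
by apply: (hm (s, t)); split; rewrite /= in_itv.
Unshelve. all: by end_near. Qed.

Definition sample f (n i : nat) : R * R := f (i%:R / n%:R).

Lemma sample_itv (n i : nat) : (i <= n)%N -> 0 <= (i%:R / n%:R : R) <= 1.
Proof.
(* For [n = 0] the quotient is 0 by convention. *)
move=> i_n; rewrite divr_ge0 //=; case: n i_n => [|n] i_n.
  by rewrite invr0 mulr0 ler01.
by rewrite ler_pdivrMr ?ltr0n // mul1r ler_nat.
Qed.

(** Uniform continuity: on the compact set of parameter pairs whose images are at least [d] apart,
    the distance of the parameters has a lower bound [m > 0], and every [n > 1/m] works. *)
Lemma sample_fine f (d : R) : continuous f -> 0 < d ->
  \forall n \near \oo, forall i j, (i <= n)%N -> (i <= j <= i.+1)%N -> (j <= n)%N ->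
    `|sample f n i - sample f n j| < d.
Proof.
move=> fc d0; have fcc := dist_continuous fc fc.
pose A := ([set` `[0, 1]] `*` [set` `[0, 1]]) `&`
          [set st : R * R | d <= `|f st.1 - f st.2|].
have [|||m m0 hm] := @compact_pos_lb _ A (fun st => `|st.1 - st.2|).
- apply: compact_closedI; first exact: compact_unit_square.
  by apply: (@closed_comp _ _ _ [set y | d <= y]) => [x _|]; [exact: fcc | exact: closed_ge].
- by apply: (@dist_continuous R R R^o id id) => x; exact: cvg_id.
- move=> [s t] /= [_ /= dst]; rewrite normr_gt0 subr_eq0.
  by apply: contraTN dst => /eqP ->; rewrite subrr normr0 -ltNge.
near=> n => i j i_n ij j_n; rewrite ltNge; apply/negP => dij.
have : m <= `|i%:R / n%:R - j%:R / n%:R : R|.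
  apply: (hm (i%:R / n%:R, j%:R / n%:R)); split => //=.
  by rewrite !in_itv /= !sample_itv.
apply/negP; rewrite -ltNge -mulrBl normrM normfV (ger0_norm (ler0n _ n)).
have n0 : (0 < n)%N by near: n; exact: nbhs_infty_gt.
rewrite ltr_pdivrMr ?ltr0n // (@le_lt_trans _ _ 1) //; last first.
  by rewrite mulrC -ltr_pdivrMr // mul1r; near: n; exact: nbhs_infty_gtr.
have [->|->] : j = i \/ j = i.+1 by lia.
  by rewrite subrr normr0.
by rewrite -natr1 opprD addNKr normrN1.
Unshelve. all: by end_near. Qed.
End Arcs.

Lemma subBB (U : zmodType) (u w z z' : U) : (u - z) - (w - z') = (u - w) - (z - z').
Proof. by rewrite !opprD !opprK addrACA. Qed.

Lemma near_forall2 (T : Type) (I : finType) (F : set_system T) {FF : Filter F}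
    (Q : I -> I -> T -> Prop) : (forall x y, \forall t \near F, Q x y t) ->
  \forall t \near F, forall x y, Q x y t.
Proof.
move=> H; apply: (@filter_forall T I (fun x t => forall y, Q x y t)) => x.
by apply: (@filter_forall T I (fun y t => Q x y t)).
Qed.

(** * Winding of a drawing around a point *)

Section Certificate.
Variables (R : realType) (V : finType) (e : rel V).
Variables (p : V -> R * R) (f : V -> V -> R -> R * R).
Hypothesis f_cont : forall x y, e x y -> continuous (f x y).
Hypothesis f0 : forall x y, e x y -> f x y 0 = p x.
Hypothesis f1 : forall x y, e x y -> f x y 1 = p y.

Definition arc_turn (n : nat) (z : R * R) (x y : V) : int :=
  turn (fun i => quad (sample (f x y) n i - z)) n.

Definition clear_at (S : {set V}) (z : R * R) (m : R) : Prop :=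
  (forall x, x \in S -> m <= `|p x - z|) /\
  (forall x y, x \in S -> y \in S -> e x y ->
     forall s, 0 <= s <= 1 -> m <= `|f x y s - z|).

(* The directions from [z] to the vertices in [S], measured in quarter turns,
   lift to integers compatible with the rotation along every arc: the drawing
   restricted to [S] does not wind around [z]. *)
Definition unwound_at (S : {set V}) (z : R * R) : Prop :=
  exists g : V -> int,
    (forall x, x \in S -> exists c : int, g x = (quad (p x - z))%:Z + 4 * c) /\
    \forall n \near \oo, forall x y, x \in S -> y \in S -> e x y ->
      arc_turn n z x y = g y - g x.

Lemma sample0 x y n : e x y -> sample (f x y) n 0 = p x.
Proof. by move=> exy; rewrite /sample mul0r f0. Qed.

Lemma samplen x y n : (0 < n)%N -> e x y -> sample (f x y) n n = p y.
Proof. by move=> n0 exy; rewrite /sample divff ?f1 // pnatr_eq0; lia. Qed.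

Lemma near_all_arcs_fine (d : R) : 0 < d ->
  \forall n \near \oo, (0 < n)%N /\ forall x y, e x y ->
    forall i j, (i <= n)%N -> (i <= j <= i.+1)%N -> (j <= n)%N ->
      `|sample (f x y) n i - sample (f x y) n j| < d.
Proof.
move=> d0; have fine : \forall n \near \oo, forall x y, e x y ->
    forall i j, (i <= n)%N -> (i <= j <= i.+1)%N -> (j <= n)%N ->
      `|sample (f x y) n i - sample (f x y) n j| < d.
  apply: near_forall2 => x y.
  case: (boolP (e x y)) => [exy|_]; last exact: nearW.
  by apply: filterS (sample_fine (f_cont exy) d0) => n ? _.
by near=> n; split; near: n => //; exact: nbhs_infty_gt.
Unshelve. all: by end_near. Qed.

(** Each lift is corrected by the step between the directions from [z] and from [z']; by
    [turn_parallel] the rotation along an arc changes by just these corrections. *)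
Lemma unwound_near S z z' m : 0 < m -> clear_at S z m -> `|z - z'| < m / 2 ->
  unwound_at S z -> unwound_at S z'.
Proof.
move=> m0 [pS fS] zz' [g [gmod gturn]].
have nqr (u w : R * R) : `|u - z| >= m -> `|u - w| < m / 2 ->
    ~~ opposite (quad (u - z)) (quad (w - z')).
  move=> uz uw; apply: near_quad; apply: lt_le_trans uz; rewrite subBB.
  by apply: le_lt_trans (ler_normB _ _) _; lra.
exists (fun x => g x + qstep (quad (p x - z)) (quad (p x - z'))); split.
  move=> x xS; have [c gx] := gmod x xS.
  have [c' ->] := qstep_mod (quad_lt4 _) (quad_lt4 _)
    (nqr (p x) (p x) (pS x xS) ltac:(by rewrite subrr normr0; lra)).
  by exists (c - c'); lia.
have fine := near_all_arcs_fine (d := m / 2) ltac:(lra).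
near=> n => x y xS yS exy.
have [n0 fine_n] : (0 < n)%N /\ forall x y, e x y ->
    forall i j, (i <= n)%N -> (i <= j <= i.+1)%N -> (j <= n)%N ->
      `|sample (f x y) n i - sample (f x y) n j| < m / 2 by near: n.
have gturn_n : arc_turn n z x y = g y - g x by move: x y xS yS exy; near: n.
have : arc_turn n z' x y - arc_turn n z x y =
    qstep (quad (p y - z)) (quad (p y - z')) - qstep (quad (p x - z)) (quad (p x - z')).
  rewrite -(sample0 n exy) -(samplen n0 exy).
  apply: turn_parallel => [i|i|i j i_n ij j_n]; try exact: quad_lt4.
  have sz k : (k <= n)%N -> m <= `|sample (f x y) n k - z|.
    by move=> k_n; apply: fS => //; apply: sample_itv.
  have sij := fine_n x y exy i j i_n ij j_n.
  have szi := sz i i_n.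
  split; [| |exact: nqr]; apply: near_quad; rewrite subBB subrr subr0; first by lra.
  have : `|sample (f x y) n i - z| <= `|sample (f x y) n i - z'| + `|z - z'|.
    by rewrite (distrC z z'); exact: ler_distD.
  lra.
lia.
Unshelve. all: by end_near. Qed.

Lemma clear_exists (S : {set V}) z : (forall x, x \in S -> p x != z) ->
  (forall x y, x \in S -> y \in S -> e x y ->
     forall s, 0 <= s <= 1 -> f x y s != z) ->
  exists2 m, 0 < m & clear_at S z m.
Proof.
move=> pz fz.
have pm : \forall m \near 0^'+, forall x, x \in S -> m <= `|p x - z|.
  apply: filter_forall => x; case: (boolP (x \in S)) => [xS|_]; last exact: nearW.
  near=> m => _; near: m; apply: nbhs_right_le.
  by rewrite normr_gt0 subr_eq0 pz.
have fm : \forall m \near 0^'+, forall x y, x \in S -> y \in S -> e x y ->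
    forall s, 0 <= s <= 1 -> m <= `|f x y s - z|.
  apply: near_forall2 => x y.
  case: (boolP [&& x \in S, y \in S & e x y]) => [/and3P[xS yS exy]|]; last first.
    by move=> H; apply: nearW => m xS yS exy; rewrite xS yS exy in H.
  have zc : continuous (fun _ : R => z) by move=> t; exact: cvg_cst.
  have H := arcs_separated (f_cont exy) zc.
  apply: filterS (H _) => [m Hm _ _ _ s s01|s t s01 _]; first exact: (Hm s s).
  exact: fz.
near (0 : R)^'+ => m; exists m; first by near: m; exact: nbhs_right_gt.
by split; near: m.
Unshelve. all: by end_near. Qed.

Lemma drawing_bounded : exists2 B, 0 < B & (forall x, `|p x| <= B) /\
  forall x y, e x y -> forall s, 0 <= s <= 1 -> `|f x y s| <= B.
Proof.
have pB : \forall B \near +oo, forall x, `|p x| <= B.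
  apply: (@filter_forall R V (fun x B => `|p x| <= B)) => x.
  exact: (@nbhs_pinfty_ge R _ (normr_real _)).
have fB : \forall B \near +oo, forall x y, e x y ->
    forall s, 0 <= s <= 1 -> `|f x y s| <= B.
  apply: near_forall2 => x y; case: (boolP (e x y)) => [exy|_]; last exact: nearW.
  have bd : bounded_set (f x y @` `[0, 1]).
    apply: compact_bounded; apply: continuous_compact; last exact: segment_compact.
    exact: continuous_subspaceT (f_cont exy).
  have {}bd : \forall B \near +oo, forall z, (f x y @` `[0, 1]) z -> `|z| <= B.
    exact: bd.
  by apply: filterS bd => B H _ s s01; apply: H; exists s => //; rewrite /= in_itv.
near (+oo_R : set_system R) => B; exists B; first by near: B; exact: nbhs_pinfty_gt.
by split; near: B.
Unshelve. all: by end_near. Qed.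

(** If the drawing has norm at most [B], its points are at most [2B] apart but farther than [2B]
    from [z], so no two lie in opposite quadrants. The direction to the origin is the reference. *)
Lemma unwound_far S : exists M : R, forall z : R * R, M < `|z| -> unwound_at S z.
Proof.
have [B B0 [pB fB]] := drawing_bounded.
exists (3 * B) => z zB.
have nopp (u w : R * R) : `|u| <= B -> `|w| <= B ->
    ~~ opposite (quad (u - z)) (quad (w - z)).
  move=> uB wB; apply: near_quad; rewrite subBB subrr subr0.
  have H1 := ler_normB u w; have := ler_normB u (u - z); rewrite subKr => H2.
  lra.
have n0 : `|0 : R * R| <= B by rewrite normr0 ltW.
exists (fun x => (quad (0 - z))%:Z + qstep (quad (0 - z)) (quad (p x - z))); split.
  move=> x xS; have [c ->] := qstep_mod (quad_lt4 _) (quad_lt4 _) (nopp _ _ n0 (pB x)).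
  by exists (- c); rewrite mulrN addrK.
near=> n => x y _ _ exy.
have n_gt0 : (0 < n)%N by near: n; exact: nbhs_infty_gt.
rewrite /arc_turn turn_const => [|i|i j i_n j_n]; first last.
- by apply: nopp; apply: fB => //; exact: sample_itv.
- exact: quad_lt4.
rewrite sample0 // samplen // -(qstep_add (quad_lt4 (0 - z)) (quad_lt4 (p x - z))
  (quad_lt4 (p y - z))) ?nopp //.
by rewrite opprD addrACA subrr add0r addrAC subrr add0r.
Unshelve. all: by end_near. Qed.

Section Face.
Variable F : set (R * R).
Hypothesis F_conn : connected F.
Hypothesis F_unbounded : ~ bounded_set F.
Hypothesis F_vertex : forall x, ~ F (p x).
Hypothesis F_arc : forall x y, e x y -> forall s, 0 <= s <= 1 -> ~ F (f x y s).

(** Being unwound is locally constant on [F], which is connected, and it holds far out, where [F]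
    has points. *)
Lemma unwound_face z : F z -> unwound_at [set: V]%SET z.
Proof.
pose U := unwound_at [set: V]%SET.
have loc w : F w -> nbhs w U \/ nbhs w (~` U).
  move=> Fw; have [||m m0 cl] := @clear_exists [set: V]%SET w.
  - by move=> x _; apply: contra_notN (@F_vertex x) => /eqP ->.
  - by move=> x y _ _ exy s s01; apply: contra_notN (F_arc exy s01) => /eqP ->.
  have nb : \forall w' \near w, `|w - w'| < m / 4.
    by apply/nbhs_normP; exists (m / 4) => //=; lra.
  (* At [w'] a clearance of [m / 2] remains, so [unwound_near] also leads back from [w'] to [w]. *)
  have cl' w' : `|w - w'| < m / 4 -> clear_at [set: V]%SET w' (m / 2).
    move=> ww'; have H u : m <= `|u - w| -> m / 2 <= `|u - w'|.
      by have := ler_distD w' u w; rewrite (distrC w' w) => H1 H2; lra.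
    by case: cl => c1 c2; split => *; apply: H; [exact: c1 | exact: c2].
  have [Uw|Uw] := pselect (U w); [left | right]; apply: filterS nb => w' ww'.
    by apply: (unwound_near m0 cl) Uw; lra.
  move=> Uw'; apply: Uw; apply: (unwound_near _ (cl' w' ww')) Uw'; first lra.
  by rewrite distrC; lra.
have [M far] := unwound_far [set: V]%SET.
have [w Fw Mw] : exists2 w, F w & M < `|w|.
  apply: contrapT => H; apply: F_unbounded.
  suff : \forall B \near +oo, forall w, F w -> `|w| <= B by [].
  near=> B => w Fw.
  apply: (@le_trans _ _ M); last first.
    by near: B; apply: nbhs_pinfty_ge; exact: num_real.
  by rewrite leNgt; apply/negP => Mw; apply: H; exists w.
suff -> : F = F `&` interior U by move=> [_ /interior_subset].
apply/esym; apply: F_conn.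
- exists w; split=> //; case: (loc w Fw) => // /nbhs_singleton /= [].
  exact: far.
- by exists (interior U) => //; exact: open_interior.
- exists (~` interior (~` U)); first by apply: open_closedC; exact: open_interior.
  apply/seteqP; split => u [Fu Uu]; split => //.
    by move=> /interior_subset /=; apply; exact: interior_subset Uu.
  by case: (loc u Fu).
Unshelve. all: by end_near. Qed.

Hypothesis arc_vertex : forall x y v, e x y -> v != x -> v != y ->
  forall s, 0 <= s <= 1 -> f x y s != p v.
Hypothesis p_inj : injective p.
Hypothesis arc_arc : forall a b x y, e a b -> e x y ->
  [&& a != x, a != y, b != x & b != y] ->
  forall s t, 0 <= s <= 1 -> 0 <= t <= 1 -> f a b s != f x y t.
Hypothesis F_closure : forall x, closure F (p x).

(** Without [v] and its arcs the drawing keeps away from [p v], so the property passes to [p v] from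
    a nearby point of [F]. *)
Lemma unwound_vertex v : unwound_at [set~ v]%SET (p v).
Proof.
have [||m m0 cl] := @clear_exists [set~ v]%SET (p v).
- by move=> x; rewrite !inE; apply: contraNN => /eqP /p_inj ->.
- move=> x y; rewrite !inE => xv yv exy s s01.
  by apply: arc_vertex => //; rewrite eq_sym.
have nb : \forall z \near p v, `|p v - z| < m / 4.
  by apply/nbhs_normP; exists (m / 4) => //=; lra.
have [z [Fz /= vz]] := F_closure nb.
apply: (@unwound_near _ z _ (m / 2)); first lra.
- have H u : m <= `|u - p v| -> m / 2 <= `|u - z|.
    by have := ler_distD z u (p v); rewrite (distrC z) => H1 H2; lra.
  by case: cl => c1 c2; split => *; apply: H; [exact: c1 | exact: c2].
- by rewrite distrC; lra.
have [g [g1 g2]] := unwound_face Fz; exists g; split => [x _|].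
  by apply: g1; rewrite inE.
by apply: filterS g2 => n g2 x y _ _; apply: g2; rewrite inE.
Qed.

(** This is [turn_square] for the directions from samples of [ab] to samples of [xy]: rows are turns
    of [xy], columns turns of [ab] seen in the opposite direction, which [turn_opposite]
    corrects. *)
Lemma arc_turn_square n m a b x y : (0 < n)%N -> e a b -> e x y ->
  (forall s t, 0 <= s <= 1 -> 0 <= t <= 1 -> m <= `|f x y s - f a b t|) -> 0 < m ->
  (forall x y, e x y -> forall i j, (i <= n)%N -> (i <= j <= i.+1)%N -> (j <= n)%N ->
      `|sample (f x y) n i - sample (f x y) n j| < m / 2) ->
  arc_turn n (p b) x y - arc_turn n (p a) x y
    = arc_turn n (p y) a b - arc_turn n (p x) a b.
Proof.
move=> n0 eab exy sep m0 fine.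
pose G i j := quad (sample (f x y) n j - sample (f a b) n i).
have sepn i j : (i <= n)%N -> (j <= n)%N ->
    m <= `|sample (f x y) n j - sample (f a b) n i|.
  by move=> i_n j_n; apply: sep; exact: sample_itv.
have := @turn_square G n (fun _ _ => quad_lt4 _).
have column j : (j <= n)%N ->
    turn (G^~ j) n = arc_turn n (sample (f x y) n j) a b.
  move=> j_n; rewrite /arc_turn -turn_opposite; last by move=> i; exact: quad_lt4.
  apply: eq_turn => i i_n; rewrite /G -quadN ?opprB // -normr_gt0.
  exact: lt_le_trans m0 (sepn _ _ i_n j_n).
rewrite !column // !(sample0, samplen) // => <-.
  by rewrite /G /= sample0 // samplen.
move=> i j i' j' i_n j_n i'_n j'_n ii' jj'; apply: near_quad.
apply: lt_le_trans (sepn _ _ i_n j_n); rewrite subBB.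
apply: le_lt_trans (ler_normB _ _) _.
have := fine _ _ eab i i' i_n ii' i'_n; have := fine _ _ exy j j' j_n jj' j'_n.
by move=> H1 H2; lra.
Qed.

Lemma drawing_certificate : exists k : V -> V -> int,
  (forall a b, a != b -> k a b + k b a + 1 = 0) /\
  (forall a b x y, e a b -> e x y -> [&& a != x, a != y, b != x & b != y] ->
     k a x - k b x = k a y - k b y).
Proof.
have /choice [g g_unwound] := unwound_vertex.
(* The division is exact, as opposite directions lie two quarter turns apart modulo 4. *)
pose k a b := ((g a b - g b a - 2) %/ 4)%Z; exists k.
have k_spec a b : a != b -> g a b - g b a = 4 * k a b + 2.
  move=> ab; have [] := g_unwound a; case/(_ b); first by rewrite !inE eq_sym.
  move=> c gab _; have [] := g_unwound b; case/(_ a); first by rewrite !inE.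
  move=> c' gba _; rewrite /k.
  have ab0 : p b - p a != 0.
    by rewrite subr_eq0; apply: contra_neq ab => /p_inj.
  have := quadN ab0; have := quad_lt4 (p b - p a); rewrite opprB.
  move: (quad _) (quad _) gab gba => q q' gab gba; lia.
split=> [a b ab|a b x y eab exy dis].
  have := k_spec a b ab; have := k_spec b a; rewrite eq_sym ab => /(_ isT); lia.
have sep : \forall m \near 0^'+, forall s t, 0 <= s <= 1 -> 0 <= t <= 1 ->
    m <= `|f x y s - f a b t|.
  apply: arcs_separated; [exact: f_cont|exact: f_cont|].
  by move=> s t s01 t01; rewrite eq_sym; exact: arc_arc.
near (0 : R)^'+ => m.
have m0 : 0 < m by near: m; exact: nbhs_right_gt.
have sepm : forall s t, 0 <= s <= 1 -> 0 <= t <= 1 -> m <= `|f x y s - f a b t|.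
  by near: m; exact: sep.
have turns : \forall n \near \oo, forall v x y, x \in [set~ v]%SET ->
    y \in [set~ v]%SET -> e x y -> arc_turn n (p v) x y = g v y - g v x.
  by apply: filter_forall => v; have [] := g_unwound v.
have fine := near_all_arcs_fine (d := m / 2) ltac:(lra).
near \oo => n.
have [n0 finen] : (0 < n)%N /\ forall x y, e x y ->
    forall i j, (i <= n)%N -> (i <= j <= i.+1)%N -> (j <= n)%N ->
      `|sample (f x y) n i - sample (f x y) n j| < m / 2 by near: n.
have turnsn : forall v x y, x \in [set~ v]%SET ->
    y \in [set~ v]%SET -> e x y -> arc_turn n (p v) x y = g v y - g v x by near: n.
(* In terms of the lifts, and grouped by pairs of vertices, this equation is four times the required
   one. *)
have := arc_turn_square n0 eab exy sepm m0 finen.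
case/and4P: dis => ax ay bx by_.
rewrite !turnsn ?inE ?ax ?ay ?bx ?by_ // 1?eq_sym // => E.
have := k_spec _ _ ax; have := k_spec _ _ ay; have := k_spec _ _ bx.
have := k_spec _ _ by_; lia.
Unshelve. all: by end_near. Qed.
End Face.
End Certificate.

Lemma is_arc_param (R : realType) (a b : R * R) (A : set (R * R)) : is_arc a b A ->
  exists f : R -> R * R,
    [/\ continuous f, f 0 = a, f 1 = b & forall s, 0 <= s <= 1 -> A (f s)].
Proof.
move=> [f [fc _ fa fb ->]].
(* Retracting the line onto the unit interval makes the parametrisation continuous everywhere. *)
pose clamp (s : R) : R := Order.max 0 (Order.min 1 s).
have clamp01 s : `[0, 1]%classic (clamp s).
  by rewrite /= in_itv /= /clamp le_max lexx ge_max ler01 ge_min lexx.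
have clamp_id s : 0 <= s <= 1 -> clamp s = s.
  by move=> /andP[s0 s1]; rewrite /clamp min_r // max_r.
have clamp_cont : continuous clamp.
  move=> s; apply: continuous_max; first exact: cvg_cst.
  by apply: continuous_min; [exact: cvg_cst | exact: cvg_id].
have /subspace_continuousP fc' := fc.
exists (f \o clamp); split.
- move=> s U /= fU.
  have H : \forall t \near clamp s, `[0, 1]%classic t -> U (f t).
    exact: (fc' _ (clamp01 s) _ fU).
  have {}H : \forall t \near s, `[0, 1]%classic (clamp t) -> U (f (clamp t)).
    exact: (clamp_cont s _ H).
  by apply: filterS H => t; apply; exact: clamp01.
- by rewrite /= clamp_id // lexx ler01.
- by rewrite /= clamp_id // lexx ler01.
- by move=> s s01; exists (clamp s).
Qed.

Lemma outerplanar_certificate (R : realType) (V : finType) (e : rel V) :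
  outerplanar R e -> exists k, edge_certificate e k.
Proof.
move=> [D [F [[[z0 z0D FE] F_unb] F_cl]]].
have F_off z : F z -> ~ dsupport D z.
  by rewrite FE => /connected_component_sub.
have /choice [f f_spec] : forall xy : V * V, exists f : R -> R * R,
    e xy.1 xy.2 -> [/\ continuous f, f 0 = dpoint D xy.1, f 1 = dpoint D xy.2 &
      forall s, 0 <= s <= 1 -> darc D [set xy.1; xy.2]%SET (f s)].
  move=> [x y] /=; case: (boolP (e x y)) => [exy|_]; last by exists (fun=> 0).
  by have [f Hf] := is_arc_param (darc_is_arc D exy); exists f.
have [|||||||||||k k_spec] := @drawing_certificate R V e (dpoint D) (fun x y => f (x, y))
  _ _ _ F; last by exists k.
- by move=> x y exy; have [] := f_spec (x, y) exy.
- by move=> x y exy; have [] := f_spec (x, y) exy.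
- by move=> x y exy; have [] := f_spec (x, y) exy.
- by rewrite FE; exact: component_connected.
- exact: F_unb.
- by move=> x Fx; apply: (F_off _ Fx); left; exists x.
- move=> x y exy s s01 Fs; apply: (F_off _ Fs); right; exists x, y; split => //.
  by have [_ _ _] := f_spec (x, y) exy; apply.
- move=> x y v exy vx vy s s01; apply/eqP => fsv.
  have [_ _ _ /(_ s s01)] := f_spec (x, y) exy; rewrite fsv.
  by move=> /(darc_vertex exy); rewrite !inE (negPf vx) (negPf vy).
- exact: dpoint_inj.
- move=> a b x y eab exy /and4P[ax ay bx by_] s t s01 t01; apply/eqP => fst.
  have [_ _ _ /(_ s s01) H1] := f_spec (a, b) eab.
  have [_ _ _ /(_ t t01) H2] := f_spec (x, y) exy.
  have [||v _ vE] := @darc_disjoint R V e D a b x y eab exy _ (f (a, b) s).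
  + apply/eqP => /setP /(_ a).
    by rewrite !inE eqxx (negPf ax) (negPf ay).
  + by split => //; rewrite fst.
  rewrite -fst -vE in H2; rewrite -vE in H1.
  (* A common point of the two arcs is a vertex, and it would be an end of both edges. *)
  have := darc_vertex eab H1; have := darc_vertex exy H2; rewrite !inE.
  by move=> /orP[] /eqP -> /orP[] /eqP E; move: ax ay bx by_; rewrite E ?eqxx.
- exact: F_cl.
Qed.

Local Close Scope classical_set_scope.

Theorem theorem5p3 (R : realType) (V : finType) (e : rel V)
  (e_sym : symmetric e) (e_irr : irreflexive e)
  (e_mop : maximal_outerplanar R e) (n_ge3 : (3 <= #|V|)%N) :
  kappa_bar_max R e
    <= 3 / 2 + (#|V|%:R - 5) / (#|V|%:R * (#|V|%:R - 1)).
Proof.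
have [k ek] := outerplanar_certificate e_mop.1.
have [||pos pos_inj nc] := @certificate_noncrossing V k #|V| e finset.setT _ e_sym e_irr _ ek.
- exact: max_card.
- by move=> a b _; rewrite finset.in_setT.
have {}pos_inj : injective pos.
  by move=> a b; apply: pos_inj; rewrite finset.in_setT.
have n_gt : 3 <= #|V|%:R :> R by rewrite ler_nat.
have bound : forall D, is_orientation e D ->
    kappa_bar R D <= 3 / 2 + (#|V|%:R - 5) / (#|V|%:R * (#|V|%:R - 1)).
  move=> D D_or; have := sum_kappa_le e_sym e_irr D_or pos_inj nc n_ge3.
  rewrite /kappa_bar -natr_sum -(ler_nat R) !natrD !natrM -subn1 natrB; last lia.
  move: (\sum_(_ | _) _)%N => t; move: n_gt; move: (#|V|%:R : R) (t%:R : R) => n s n3 le.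
  have n0 : 0 < n * (n - 1) by nra.
  rewrite mulrC ler_pdivrMr // mulrDl divfK ?gt_eqF //; lra.
(* The maximum has default value 0, so the bound must also be shown to be nonnegative. *)
rewrite /kappa_bar_max; apply: bigmax_le => //.
set n : R := #|V|%:R; have n3 : 3 <= n := n_gt.
have n0 : 0 < n * (n - 1) by nra.
have -> : 3 / 2 + (n - 5) / (n * (n - 1)) = (3 * (n * (n - 1)) + 2 * (n - 5)) / (2 * (n * (n - 1))).
  by field; rewrite !gt_eqF //; nra.
by apply: divr_ge0; nra.
Qed.
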